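(* Let $a\ge 1$, $a\ge b\ge 0$ be integers, $n=a+b$, $\pi\in\mathfrak S_n$, let $\Gamma=\Gamma_\pi$ be the consistent dimer model associated to $\Delta(a,b)$, $Q$ its dual quiver, and let $\omega\mapsto C_\omega$ be the one-to-one correspondence between $\mathfrak S_n$ (equivalently, the sequences $\mathcal Z_\omega=(u_{\omega(1)},\dots,u_{\omega(n)})$ of zigzag paths) and the chambers of $\Theta(Q)_{\mathbb R}$ described in the context, with walls $W_{1},\dots,W_{n-1}$ of $C_\omega$, $W_{k}=\{\theta\mid\sum_{v\in\mathcal R(u_{\omega(k)},u_{\omega(k+1)})}\theta_v=0\}$. Then for each $\omega\in\mathfrak S_n$ and $k=1,\dots,n-1$ the action of the adjacent transposition $s_k\in\mathfrak S_n$ swapping $k$ and $k+1$ on $\mathcal Z_\omega$ induces the crossing of the wall $W_k$: the chamber adjacent to $C_\omega$ and separated from it by $W_k$ is $C_{\omega s_k}$, which corresponds to $\mathcal Z_{\omega s_k}$. In particular, the chambers in $\Theta(Q)_{\mathbb R}$ can be identified with the Weyl chambers of type $A_{n-1}$ (the wall-and-chamber structure of $\Theta(Q)_{\mathbb R}$ is that of the root system of type $A_{n-1}$).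
   Context: **Dimer models, quivers, stability.** A dimer model $\Gamma$ is a finite bipartite graph (nodes coloured black or white) on $\mathbb T=\mathbb R^2/\mathbb Z^2$ inducing a polygonal cell decomposition. A zigzag path is a closed path making a maximal turn to the right at each black node and a maximal turn to the left at each white node; its slope $[z]\in H_1(\mathbb T)\cong\mathbb Z^2$ is its homology class. The quiver $Q$ dual to $\Gamma$ has the faces as vertices and the edges as arrows, an arrow crossing its edge with the white node on the right. Relations: for every arrow $a$, $\gamma_a^+=\gamma_a^-$, where $\gamma_a^+$ (resp. $\gamma_a^-$) is the path from the head of $a$ to the tail of $a$ going around the white (resp. black) node of the edge dual to $a$. Representations are representations of $Q$ over $\mathbb C$ satisfying these relations, of dimension vector $(1,\dots,1)$. Put $\Theta(Q)_{\mathbb R}=\{\theta\in\mathbb R^{Q_0}\mid\sum_v\theta_v=0\}$ and $\theta(N)=\sum_v\theta_v\dim N_v$. A representation $M$ is $\theta$-semistable (resp. $\theta$-stable) if $\theta(N)\ge0$ for all subrepresentations $N$ (resp. $\theta(N)>0$ for all nonzero proper $N$); $\theta$ is generic if every $\theta$-semistable representation is $\theta$-stable. Two generic parameters are equivalent if they have the same stable representations; equivalence classes are open cones called chambers, and walls are codimension one faces of closures of chambers (a hyperplane is called a wall of $C$ if it is spanned by such a face of $\overline C$). **The dimer model $\Gamma_\pi$.** $\Delta(a,b)$ is the polygon with vertices $(0,0),(a,0),(b,1),(0,1)$, the toric diagram of $R_{a,b}=\mathbb C[x,y,z,w]/(xy-z^aw^b)$. Put $i_k=-1$ for $k\le a$,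 $i_k=+1$ for $a<k\le n$; arguments of $\pi$ are read modulo $n$ in $\{1,\dots,n\}$. Let $S$ be a vertical infinite chain of rhombi of side $1$ with horizontal diagonal $1$ and vertical diagonal $\sqrt3$, consecutive ones sharing a vertex; let $H$ be a vertical infinite chain of regular hexagons of side $1$, consecutive ones sharing a horizontal edge. Tile the plane by strips indexed by $k\in\mathbb Z$ from left to right, consecutive strips glued along their zigzag boundary lines, strip $k$ being a copy of $S$ if $i_{\pi(k)}\ne i_{\pi(k+1)}$ and of $H$ otherwise; label every polygon of strip $k$ by $k$ mod $n$. Colour the vertices bipartitely and divide by the lattice generated by the upward translation by one polygon (second basis vector of $H_1(\mathbb T)$) and a translation carrying strip $0$ to strip $n$ (first basis vector). The colouring and the second translation are chosen so that the zigzag polygon of the resulting dimer model is $\Delta(a,b)$ (up to translation), i.e. the slopes of its zigzag paths with multiplicity are $(0,-1)$ ($a$ times), $(0,1)$ ($b$ times), $(1,a-b)$, $(-1,0)$. The result is $\Gamma_\pi$; its faces (vertices of $Q$) are labelled $0,\dots,n-1$. **Zigzag paths $u_k$.** For $k=1,\dots,n$, $u_k$ is the zigzag path formed by the boundary line between strips $k-1$ and $k$ (edges shared by the faces $k-1$ and $k$ mod $n$); order them by $u_n<\cdots<u_1$. For $i\ne j$, $u_i$ and $u_j$ cut $\mathbb T$ into two parts, and $\mathcal R(u_i,u_j)\subset Q_0$ is the set of vertices dual to faces in the part not containing the face $0$; explicitly $\{\min(i,j),\dots,\max(i,j)-1\}$. **The correspondence.** $\omega\mapsto C_\omega$ is the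 bijection from $\mathfrak S_n$ to the set of chambers such that for all $k=1,\dots,n-1$, with $\mathcal R_k=\mathcal R(u_{\omega(k)},u_{\omega(k+1)})$, the hyperplane $W_k=\{\sum_{v\in\mathcal R_k}\theta_v=0\}$ is a wall of $C_\omega$, and every $\theta\in C_\omega$ satisfies $\sum_{v\in\mathcal R_k}\theta_v>0$ if $u_{\omega(k)}<u_{\omega(k+1)}$ and $\sum_{v\in\mathcal R_k}\theta_v<0$ if $u_{\omega(k)}>u_{\omega(k+1)}$. The symmetric group acts by $s_k\cdot\mathcal Z_\omega=\mathcal Z_{\omega s_k}$, i.e. swapping the $k$-th and $(k+1)$-st entries. *)

(* Defs.v *)
From HB Require Import structures.
From Stdlib Require Import Relations.
From mathcomp Require Import all_boot all_order all_algebra fingroup perm.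
From mathcomp Require Import complex.
From mathcomp Require Import boolp classical_sets reals topology num_topology.

Set Implicit Arguments.
Unset Strict Implicit.
Unset Printing Implicit Defensive.

Import Order.TTheory GRing.Theory Num.Theory.
Import numFieldTopology.Exports.

Local Open Scope classical_set_scope.
Local Open Scope ring_scope.

(* A dimer model on T = R^2/Z^2, encoded by its rotation system:
   wnext x = the edge following x clockwise around the white end of x,
   bnext x = the edge following x counterclockwise around the black end of x,
   lface x = the face on the left of x when x is traversed from white to black.
   (These are the directions in which the arrows of the dual quiver turn around
   the nodes.)  Keeping a face on the left, x (from white to black) is followed
   by finv bnext x (from black to white), then by wnext (finv bnext x): hence
   the faces are the orbits in lfaceP.
   The embedding in R^2/Z^2 is recorded by choosing a lift to R^2 of every
   node: if the white end of a lift of x is the chosen lift translated by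
   p : Z^2, then its black end is the chosen lift translated by p + disp x.
   dispP says that the boundary of every face lifts to a closed path, and
   cover_connected that the lifted graph is connected; together with euler
   (the genus is 1) this makes x |-> disp x induce an isomorphism from the first
   homology group onto Z^2. *)
Record dimer := Dimer {
  white : finType;
  black : finType;
  edge : finType;
  nface : nat;
  wend : edge -> white;
  bend : edge -> black;
  lface : edge -> 'I_nface;
  wnext : edge -> edge;
  bnext : edge -> edge;
  disp : edge -> int * int;
  wnext_inj : injective wnext;
  bnext_inj : injective bnext;
  wendP : forall x y, fconnect wnext x y = (wend x == wend y);
  bendP : forall x y, fconnect bnext x y = (bend x == bend y);
  lfaceP : forall x y,
    fconnect (fun z => wnext (finv bnext z)) x y = (lface x == lface y);
  wend_surj : forall w, exists x, wend x = w;
  bend_surj : forall w, exists x, bend x = w;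
  lface_surj : forall v, exists x, lface x = v;
  euler : (#|white| + #|black| + nface = #|edge|)%N;
  dispP : forall v, \sum_(x | lface x == v) disp x
                    = \sum_(x | lface (wnext x) == v) disp x;
  cover_connected : forall u v : edge * (int * int),
    clos_refl_sym_trans _
      (fun x y => (wend x.1 = wend y.1 /\ x.2 = y.2)
               \/ (bend x.1 = bend y.1 /\ x.2 + disp x.1 = y.2 + disp y.1)) u v
}.

Section Zigzag.
Variable D : dimer.
Implicit Types (x : edge D) (Z : {set edge D}).

(* A maximal right turn at the black end of x leads to bnext x, and a maximal
   left turn at the white end of bnext x leads to wnext (bnext x).  Zigzag paths
   thus correspond to the orbits of zz on edges traversed from white to black. *)
Definition zz x : edge D := wnext (bnext x).

Definition zigzag x : {set edge D} :=
  [set y | [exists z, fconnect zz x z && ((y == z) || (y == bnext z))]].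

Definition slope x : int * int :=
  \sum_(y <- fingraph.orbit zz x) (disp y - disp (bnext y)).

Definition slopes : seq (int * int) := [seq slope x | x <- enum (froots zz)].

(* An arrow crosses its edge with the white node on the right, hence its tail
   is the face on the left of the edge directed from white to black. *)
Definition tail x : 'I_(nface D) := lface x.
Definition head x : 'I_(nface D) := lface (wnext x).

Definition face_adj Z : rel 'I_(nface D) :=
  [rel v w | [exists x, (x \notin Z) &&
     (((v == tail x) && (w == head x)) || ((v == head x) && (w == tail x)))]].

(* The faces that cannot be joined to the face 0 without crossing Z or Z'. *)
Definition region Z Z' : {set 'I_(nface D)} :=
  [set v | [forall v0 : 'I_(nface D), (val v0 == 0%N) ==>
              ~~ connect (face_adj (Z :|: Z')) v0 v]].

End Zigzag.

Section Stability.
Variables (R : realType) (D : dimer).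
Local Notation Q0 := 'I_(nface D).
Local Notation RQ0 := 'rV[R]_(nface D).
Implicit Types (theta : RQ0) (W : {vspace RQ0}) (C F : set RQ0).

(* A representation of dimension vector (1,...,1): every vertex carries the
   vector space C, and the arrow x acts as multiplication by M x. *)
Definition rep := edge D -> R[i].

Definition satisfies_relations (M : rep) : Prop :=
  forall x, \prod_(y <- behead (fingraph.orbit (@wnext D) x)) M y
          = \prod_(y <- behead (fingraph.orbit (@bnext D) x)) M y.

Definition subrep (M : rep) (N : Q0 -> {vspace R[i]^o}) : Prop :=
  forall x (p : R[i]^o), p \in N (tail x) -> (M x * p : R[i]^o) \in N (head x).

Definition theta_dim theta (N : Q0 -> {vspace R[i]^o}) : R :=
  \sum_v theta 0 v *+ \dim (N v).

Definition semistable theta (M : rep) : Prop :=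
  forall N, subrep M N -> 0 <= theta_dim theta N.

Definition stable theta (M : rep) : Prop :=
  forall N, subrep M N ->
    (exists v, N v != 0%VS) -> (exists v, N v != fullv) ->
    0 < theta_dim theta N.

Definition sum_on (S : {set Q0}) theta : R^o := \sum_(v in S) theta 0 v.

Definition Theta : {vspace RQ0} := lker (linfun (sum_on [set: Q0])).

Definition hyp (S : {set Q0}) : {vspace RQ0} :=
  (Theta :&: lker (linfun (sum_on S)))%VS.

Definition generic theta : Prop :=
  theta \in Theta /\
  forall M, satisfies_relations M -> semistable theta M -> stable theta M.

Definition equivalent theta theta' : Prop :=
  forall M, satisfies_relations M -> (stable theta M <-> stable theta' M).

Definition chamber C : Prop :=
  exists2 theta, generic theta &
    C = [set theta' | generic theta' /\ equivalent theta theta'].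

Definition is_face C F : Prop :=
  exists l : 'Hom(RQ0, R^o),
    (forall theta, C theta -> 0 <= l theta) /\
    F = [set theta | C theta /\ l theta = 0].

Definition spans F W : Prop :=
  (forall theta, F theta -> theta \in W) /\
  (forall U : {vspace RQ0}, (forall theta, F theta -> theta \in U) ->
     (W <= U)%VS).

Definition facet_spanning W C F : Prop :=
  [/\ is_face (closure C) F, spans F W & (\dim W).+1 = \dim Theta].

Definition is_wall C W : Prop := exists F, facet_spanning W C F.

Definition separated_by W C C' : Prop :=
  exists l : 'Hom(RQ0, R^o),
    [/\ W = (Theta :&: lker l)%VS,
        forall theta, C theta -> 0 < l theta
      & forall theta, C' theta -> l theta < 0].

Definition adjacent_across W C C' : Prop :=
  (exists F, facet_spanning W C F /\ facet_spanning W C' F) /\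
  separated_by W C C'.

End Stability.

(* In this section the ordinal j : 'I_n stands for the entry j + 1 of
   {1, ..., n} when it is an argument or a value of pi or the index of the
   boundary line u_(j+1), whereas faces and strips keep their labels
   0, ..., n - 1.  Thus the line j lies between the strips j and ordS j (that is,
   j + 1 mod n), and the strip v between the lines ord_pred v and v. *)
Section Gamma.
Variables (n a : nat) (pi : 'S_n) (c : bool) (t : int).

Definition isign (k : 'I_n) : int := if (k < a)%N then -1 else 1.

Definition hexagonal (v : 'I_n) : bool :=
  isign (pi (ord_pred v)) == isign (pi v).

(* In the plane, the line j has leftmost nodes L_(j,m) and rightmost nodes
   R_(j,m), m : Z, joined going upwards by the edges
     (j, true)  from L_(j,m) to R_(j,m)    (drawn as /),
     (j, false) from R_(j,m) to L_(j,m+1)  (drawn as \).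
   The strip between the lines i and j, in this order from left to right, is made
   of rhombi if R_(i,m) = L_(j,m) for all m, and of hexagons if these nodes are
   joined by horizontal edges.
   Passing from a line to the next one, the colour of the leftmost nodes changes
   exactly across the strips of rhombi. This leaves two colourings, indexed
   by c, in which the nodes L_(j,m) are white iff the following holds.  *)
Definition lwhite (j : 'I_n) : bool := (isign (pi j) == -1) (+) c.

(* The horizontal edges lie in the strips of hexagons. *)
Definition gedge : finType := (('I_n * bool) + {v : 'I_n | hexagonal v})%type.

Definition line (j : 'I_n) (s : bool) : gedge := inl (j, s).

(* The edge following x around its end which is a rightmost node of a line (if
   r) or a leftmost one (if not), counterclockwise if ccw and clockwise if not.
   Counterclockwise, the edges at a rightmost node of the line j are
   (j, false), (j, true), then those of the strip ordS j, namely the horizontal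
   edge or (ordS j, false), (ordS j, true). *)
Definition turn (ccw r : bool) (x : gedge) : gedge :=
  match x with
  | inl (j, s) =>
      if s == ccw then
        match insub (if r then ordS j else j) with
        | Some h => inr h
        | None => line (if r then ordS j else ord_pred j) (~~ s)
        end
      else line j (~~ s)
  | inr h => line (if r then ord_pred (val h) else val h) (~~ ccw)
  end.

Definition index_of (x : gedge) : 'I_n :=
  match x with inl (j, _) => j | inr h => val h end.

Definition gwnext (x : gedge) : gedge := turn false (~~ lwhite (index_of x)) x.
Definition gbnext (x : gedge) : gedge := turn true (lwhite (index_of x)) x.

(* The strip at whose inner boundary L_(j,m) (if not r) or R_(j,m) (if r) lies.
   A strip of rhombi has one node in the quotient, a strip of hexagons has one
   of each colour. *)
Definition gwhite : finType := {v : 'I_n | hexagonal v || lwhite v}.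
Definition gblack : finType := {v : 'I_n | hexagonal v || ~~ lwhite v}.

Definition node_strip (r : bool) (x : gedge) : 'I_n :=
  match x with
  | inl (j, _) => if r then ordS j else j
  | inr h => val h
  end.

Definition glface (x : gedge) : 'I_n :=
  match x with
  | inl (j, s) => if s == lwhite j then j else ordS j
  | inr h => val h
  end.

(* The plane tiling is divided by the upward translation by one polygon, giving
   the vector (0, 1), and by the translation L_(j,m) |-> L_(j+n,m+t) giving the
   vector (1, 0).  The chosen lifts of the nodes are L_(j,0), and R_(j,0)
   except on the last line, where R_(n-1,0) is the chosen lift translated by
   (1, -t). *)
Definition hshift (j : 'I_n) : int * int := if j.+1 == n then (1, - t) else 0.

Definition gdisp (x : gedge) : int * int :=
  match x with
  | inl (j, s) =>
      let d := hshift j - (if s then 0 else (0, 1)) in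
      if lwhite j then d else - d
  | inr _ => 0
  end.


Lemma hexagonalE v : hexagonal v = (lwhite (ord_pred v) == lwhite v).
Proof.
rewrite /hexagonal /lwhite /isign; case: c;
  by case: (pi (ord_pred v) < a)%N; case: (pi v < a)%N.
Qed.

(* The edge following x around its end of colour col (white if col). *)
Definition gnext (ccw col : bool) (x : gedge) : gedge :=
  turn ccw (col (+) lwhite (index_of x)) x.

Definition gnode (col : bool) (x : gedge) : 'I_n :=
  node_strip (col (+) lwhite (index_of x)) x.

Lemma insubT' v (hv : hexagonal v) :
  insub v = Some (exist _ v hv : {v : 'I_n | hexagonal v}).
Proof. exact: insubT. Qed.

Lemma lwhiteS j : ~~ hexagonal (ordS j) -> lwhite (ordS j) = ~~ lwhite j.
Proof. by rewrite hexagonalE ordSK; do 2 case: (lwhite _). Qed.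

Lemma lwhiteP j : ~~ hexagonal j -> lwhite (ord_pred j) = ~~ lwhite j.
Proof. by rewrite hexagonalE; do 2 case: (lwhite _). Qed.

Lemma lwhiteSh j : hexagonal (ordS j) -> lwhite (ordS j) = lwhite j.
Proof. by rewrite hexagonalE ordSK => /eqP. Qed.

Lemma gnextK ccw col : cancel (gnext ccw col) (gnext (~~ ccw) col).
Proof.
rewrite /gnext; case=> [[j s]|[v hv]] /=.
  case: (eqVneq s ccw) => [->|/negPf ne] /=; last first.
    have -> : s = ~~ ccw by move: ne; case: (s); case: (ccw).
    by rewrite negbK; case: (ccw).
  set r := col (+) lwhite j; set v := if r then ordS j else j.
  case: (boolP (hexagonal v)) => hv.
    rewrite (insubT' hv) /=.
    have -> : col (+) lwhite v = r.
      rewrite /r /v; case: {-1}r (erefl r) hv => // er.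
      rewrite /v er hexagonalE ordSK => /eqP <-.
      by rewrite -/r er.
    by rewrite negbK /v; case: (r) => //; rewrite ordSK.
  rewrite insubN //=.
  set j' := if r then ordS j else ord_pred j.
  have er' : col (+) lwhite j' = ~~ r.
    move: hv; rewrite /v /j'; case er: r => hv;
      by rewrite ?lwhiteS ?lwhiteP // addbN -/r er.
  rewrite er' eqxx.
  have -> : (if ~~ r then ordS j' else j') = v.
    by rewrite /j' /v; case: (r) => //=; rewrite ord_predK.
  rewrite insubN //= negbK /j'; case: (r) => /=; by rewrite ?ordSK ?ord_predK.
rewrite negbK /=.
set r := col (+) lwhite v.
have -> : col (+) lwhite (if r then ord_pred v else v) = r.
  have := hv; rewrite hexagonalE => /eqP e.
  by rewrite [in LHS]fun_if e if_same.
rewrite eqxx.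
have -> : (if r then ordS (if r then ord_pred v else v)
           else if r then ord_pred v else v) = v.
  by case: (r) => //; rewrite ord_predK.
by rewrite (insubT' hv).
Qed.

Lemma gnext_inj ccw col : injective (gnext ccw col).
Proof. exact: can_inj (gnextK ccw col). Qed.

Lemma gnode_next ccw col x : gnode col (gnext ccw col x) = gnode col x.
Proof.
rewrite /gnode /gnext; case: x => [[j s]|[v hv]] /=.
  case: (eqVneq s ccw) => [_|_] //=.
  case: (boolP (col (+) lwhite j)) => r /=.
    case: (boolP (hexagonal (ordS j))) => hv.
      by rewrite (insubT' hv).
    by rewrite insubN //= lwhiteS // addbN r.
  case: (boolP (hexagonal j)) => hv; first by rewrite (insubT' hv).
  by rewrite insubN //= lwhiteP // addbN r /= ord_predK.
have hv' := hv; move: hv'; rewrite hexagonalE => /eqP e.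
case: (boolP (col (+) lwhite v)) => r /=; last by rewrite (negPf r).
by rewrite e r ord_predK.
Qed.

Lemma gnext_flip ccw col j : gnext ccw col (line j (~~ ccw)) = line j ccw.
Proof. by rewrite /gnext /=; case: ccw. Qed.

Lemma gnodeP ccw col x y :
  fconnect (gnext ccw col) x y = (gnode col x == gnode col y).
Proof.
set f := gnext ccw col.
have sym : connect_sym (frel f) := fconnect_sym (@gnext_inj ccw col).
apply/idP/eqP => [/iter_findex <-|].
  by elim: (findex _ _ _) => //= m IH; rewrite gnode_next.
have flip j s : fconnect f (line j s) (line j ccw).
  case: (eqVneq s ccw) => [->|ne]; first exact: connect0.
  have -> : s = ~~ ccw by move: ne; case: (s); case: (ccw).
  by rewrite -[line j ccw](gnext_flip ccw col) fconnect1.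
have hexa (v : 'I_n) (hv : hexagonal v) z : gnode col z = v ->
    fconnect f z (inr (exist _ v hv)).
  case: z => [[j s]|[w hw]]; rewrite /gnode /= => e; last first.
    subst w; rewrite (bool_irrelevance hw hv); exact: connect0.
  apply: (connect_trans (flip j s)); apply: connect1; apply/eqP.
  by rewrite /f /gnext /= eqxx e (insubT' hv).
have rhom (v : 'I_n) (hv : ~~ hexagonal v) z : gnode col z = v ->
    fconnect f z (line v ccw).
  case: z => [[j s]|[w hw]]; rewrite /gnode /= => e; last first.
    by subst w; rewrite hw in hv.
  move: e; case: (boolP (col (+) lwhite j)) => r /= e; last by rewrite -e; exact: flip.
  apply: (connect_trans (flip j s)); apply: connect_trans (flip v (~~ ccw)).
  by apply: connect1; apply/eqP; rewrite /f /gnext /= eqxx r e insubN.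
move=> e; case: (boolP (hexagonal (gnode col y))) => hv.
  by apply: (connect_trans (hexa _ hv _ e)); rewrite sym; exact: hexa.
by apply: (connect_trans (rhom _ hv _ e)); rewrite sym; exact: rhom.
Qed.

Lemma gwnextE : gwnext =1 gnext false true.
Proof. by []. Qed.

Lemma gbnextE : gbnext =1 gnext true false.
Proof. by []. Qed.

Lemma gwnext_inj : injective gwnext.
Proof. exact: (@gnext_inj false true). Qed.

Lemma gbnext_inj : injective gbnext.
Proof. exact: (@gnext_inj true false). Qed.

Lemma gwend_subproof x : hexagonal (gnode true x) || lwhite (gnode true x).
Proof.
case: x => [[j s]|[v hv]]; rewrite /gnode /=; last by rewrite hv.
case: (boolP (lwhite j)) => /= [->|ej]; first exact: orbT.
by case: (boolP (hexagonal _)) => //= /lwhiteS ->.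
Qed.

Lemma gbend_subproof x : hexagonal (gnode false x) || ~~ lwhite (gnode false x).
Proof.
case: x => [[j s]|[v hv]]; rewrite /gnode /=; last by rewrite hv.
case: (boolP (lwhite j)) => /= [ej|->]; last exact: orbT.
by case: (boolP (hexagonal _)) => //= /lwhiteS ->; rewrite ej.
Qed.

Definition gwend (x : gedge) : gwhite := exist _ (gnode true x) (gwend_subproof x).
Definition gbend (x : gedge) : gblack := exist _ (gnode false x) (gbend_subproof x).

Lemma gwendP x y : fconnect gwnext x y = (gwend x == gwend y).
Proof. exact: (gnodeP false true). Qed.

Lemma gbendP x y : fconnect gbnext x y = (gbend x == gbend y).
Proof. exact: (gnodeP true false). Qed.

Lemma gwend_surj w : exists x, gwend x = w.
Proof.
case: w => v hv; case: (boolP (lwhite v)) => ev.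
  by exists (line v true); apply/val_inj; rewrite /= /gnode /= ev.
have hx : hexagonal v by move: hv; rewrite (negPf ev) orbF.
by exists (inr (exist _ v hx)); apply/val_inj.
Qed.

Lemma gbend_surj w : exists x, gbend x = w.
Proof.
case: w => v hv; case: (boolP (lwhite v)) => ev; last first.
  by exists (line v true); apply/val_inj; rewrite /= /gnode /= (negPf ev).
have hx : hexagonal v by move: hv; rewrite ev orbF.
by exists (inr (exist _ v hx)); apply/val_inj.
Qed.

Lemma glface_surj v : exists x, glface x = v.
Proof. by exists (line v (lwhite v)); rewrite /= eqxx. Qed.

Lemma glface_next y : glface (gwnext y) = glface (gbnext y).
Proof.
rewrite gwnextE gbnextE /gnext; case: y => [[j s]|[v hv]] /=; last first.
  have := hv; rewrite hexagonalE => /eqP e.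
  case: (boolP (lwhite v)) => ev /=; first by rewrite e ev /= ord_predK.
  by rewrite e (negPf ev) /= ord_predK.
case: s => /=; case: (boolP (lwhite j)) => ej /=.
- case: (boolP (hexagonal (ordS j))) => hv; first by rewrite (insubT' hv).
  by rewrite insubN //= lwhiteS // ej.
- case: (boolP (hexagonal j)) => hv; first by rewrite (insubT' hv).
  by rewrite insubN //= lwhiteP // ej /= ord_predK.
- case: (boolP (hexagonal j)) => hv; first by rewrite (insubT' hv).
  by rewrite insubN //= lwhiteP // ej /= ord_predK.
- case: (boolP (hexagonal (ordS j))) => hv; first by rewrite (insubT' hv).
  by rewrite insubN //= lwhiteS // ej.
Qed.

Lemma glfaceP x y :
  fconnect (fun z => gwnext (finv gbnext z)) x y = (glface x == glface y).
Proof.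
set f := (X in fconnect X).
have finj : injective f.
  exact: inj_comp gwnext_inj (finv_inj gbnext_inj).
have sym : connect_sym (frel f) := fconnect_sym finj.
have step z : fconnect f (gbnext z) (gwnext z).
  by apply: connect1; rewrite /= /f finv_f //; exact: gbnext_inj.
apply/idP/eqP => [/iter_findex <-|].
  elim: (findex _ _ _) => //= m IH; rewrite IH.
  by rewrite /f glface_next f_finv //; exact: gbnext_inj.
have main z : fconnect f (line (glface z) (lwhite (glface z))) z.
  have right v : fconnect f (line v (lwhite v))
      (if insub v is Some h then inr h
       else line (ord_pred v) (~~ lwhite (ord_pred v))).
    have := step (line v (~~ lwhite v)).
    rewrite gwnextE gbnextE /gnext /=.
    case: (boolP (lwhite v)) => ev /=; case: (boolP (hexagonal v)) => hv;
      rewrite ?(insubT' hv) ?insubN ?lwhiteP ?ev //=.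
    - by rewrite sym.
    - by rewrite sym.
  have left j : fconnect f (line j (~~ lwhite j))
      (if insub (ordS j) is Some h then inr h
       else line (ordS j) (lwhite (ordS j))).
    have := step (line j (lwhite j)).
    rewrite gwnextE gbnextE /gnext /=.
    case: (boolP (lwhite j)) => ej /=;
      case: (boolP (hexagonal (ordS j))) => hv;
      rewrite ?(insubT' hv) ?insubN ?lwhiteS ?ej //=.
    - by rewrite sym.
    - by rewrite sym.
  case: z => [[j s]|[v hv]] /=; last first.
    by have := right v; rewrite (insubT' hv).
  case: (eqVneq s (lwhite j)) => [->|ne]; first exact: connect0.
  have -> : s = ~~ lwhite j by move: ne; case: (s); case: (lwhite j).
  have := left j; have := right (ordS j).
  case: (boolP (hexagonal (ordS j))) => hv.
    rewrite (insubT' hv) => h1 h2; apply: (connect_trans h1).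
    by rewrite sym.
  by rewrite insubN // ordSK.
move=> e; have := main y; rewrite -e => h.
by apply: connect_trans h; rewrite sym; exact: main.
Qed.

Lemma geuler : (#|gwhite| + #|gblack| + n = #|gedge|)%N.
Proof.
rewrite /gwhite /gblack /gedge card_sum card_prod !card_sig card_bool card_ord.
rewrite -cardUI.
have -> : #|[predU [pred v | hexagonal v || lwhite v]
            & [pred v | hexagonal v || ~~ lwhite v]]| = n.
  rewrite -[RHS]card_ord; apply: eq_card => v; rewrite !inE.
  by case: (hexagonal v) => //=; case: (lwhite v).
have -> : #|[predI [pred v | hexagonal v || lwhite v]
            & [pred v | hexagonal v || ~~ lwhite v]]| = #|hexagonal|.
  apply: eq_card => v; rewrite !inE -[_ \in hexagonal]/(hexagonal v).
  by case: (hexagonal v) => //=; case: (lwhite v).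
by rewrite muln2 -addnn addnAC.
Qed.

Lemma grface j s : glface (gwnext (line j s)) = if s == lwhite j then ordS j else j.
Proof.
rewrite glface_next gbnextE /gnext /=; case: s => /=; last first.
  by case: (lwhite j).
case: (boolP (lwhite j)) => ej /=.
  case: (boolP (hexagonal (ordS j))) => hv; first by rewrite (insubT' hv).
  by rewrite insubN //= lwhiteS // ej.
case: (boolP (hexagonal j)) => hv; first by rewrite (insubT' hv).
by rewrite insubN //= lwhiteP // ej /= ord_predK.
Qed.

Lemma grfaceh h : glface (gwnext (inr h)) = val h.
Proof.
case: h => v hv; rewrite glface_next gbnextE /gnext /=.
have := hv; rewrite hexagonalE => /eqP e.
by case: (boolP (lwhite v)) => ev /=; rewrite ?e ?ev ?(negPf ev) /= ?ord_predK.
Qed.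

Lemma gdisp_diff j :
  gdisp (line j (lwhite j)) - gdisp (line j (~~ lwhite j)) = (0, 1).
Proof.
rewrite /gdisp /=; case: (lwhite j) => /=; set w := hshift j.
  by rewrite subr0 opprB addrC subrK.
by rewrite subr0 opprK opprB subrK.
Qed.

Lemma gdispP v : \sum_(x : gedge | glface x == v) gdisp x
               = \sum_(x : gedge | glface (gwnext x) == v) gdisp x.
Proof.
rewrite !big_sumType; congr (_ + _); last first.
  by apply: eq_bigl => h; rewrite grfaceh.
have S (P : 'I_n -> bool -> bool) (Q : pred ('I_n * bool)) :
    (forall j s, Q (j, s) = P j s) ->
    \sum_(i | Q i) gdisp (inl i)
    = \sum_(j < n) \sum_(s : bool) (if P j s then gdisp (line j s) else 0).
  move=> h; rewrite big_mkcond pair_big /=.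
  by apply: eq_bigr => -[j s] _; rewrite h.
rewrite (S (fun j s => (if s == lwhite j then j else ordS j) == v)) //.
rewrite (S (fun j s => (if s == lwhite j then ordS j else j) == v)); last first.
  by move=> j s; rewrite grface.
apply/eqP; rewrite -subr_eq0 -sumrB.
have E (j : 'I_n) : \sum_(s : bool)
    (if (if s == lwhite j then j else ordS j) == v then gdisp (line j s) else 0)
  - \sum_(s : bool)
    (if (if s == lwhite j then ordS j else j) == v then gdisp (line j s) else 0)
  = (if j == v then (0, 1) else 0) - (if ordS j == v then (0, 1) else 0).
  have B (F : bool -> int * int) :
      \sum_(s : bool) F s = F (lwhite j) + F (~~ lwhite j).
    by rewrite big_bool; case: (lwhite j) => //=; rewrite addrC.
  rewrite !B eqxx.
  have -> : (~~ lwhite j == lwhite j) = false by case: (lwhite j).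
  have D := gdisp_diff j; move: D.
  set x := gdisp _; set y := gdisp _ => D.
  by rewrite -D; case: (j == v); case: (ordS j == v);
    rewrite ?addr0 ?add0r ?subr0 ?subrr ?sub0r ?opprB ?opprD ?addrA // ?subrK
      ?subrr ?[x + y]addrC ?addrK ?subrr.
under eq_bigr => j _ do rewrite E.
rewrite sumrB subr_eq0 (reindex (@ordS n)) //.
by exists (@ord_pred n) => i _; rewrite ?ordSK ?ord_predK.
Qed.

Section CoverConnected.

Let same (x y : gedge * (int * int)) : Prop :=
  (gwend x.1 = gwend y.1 /\ x.2 = y.2)
  \/ (gbend x.1 = gbend y.1 /\ x.2 + gdisp x.1 = y.2 + gdisp y.1).

Let conn := clos_refl_sym_trans _ same.

Let conn_trans u v w : conn u v -> conn v w -> conn u w.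
Proof. by move=> h1 h2; apply: rst_trans h1 h2. Qed.

Let conn_sym u v : conn u v -> conn v u.
Proof. exact: rst_sym. Qed.

Let conn_white x y p : gnode true x = gnode true y -> conn (x, p) (y, p).
Proof. by move=> e; apply: rst_step; left; split=> //; apply/val_inj. Qed.

Let conn_black x y p q : gnode false x = gnode false y ->
  p + gdisp x = q + gdisp y -> conn (x, p) (y, q).
Proof. by move=> e1 e2; apply: rst_step; right; split=> //; apply/val_inj. Qed.

(* The edge (j, true) whose end L_(j,m) is the chosen lift translated by p. *)
Let base j p : gedge * (int * int) :=
  (line j true, if lwhite j then p else p + hshift j).

Let conn_vert j p : conn (base j p) (base j (p + (0, 1))).
Proof.
have D := gdisp_diff j; rewrite /base; case: (boolP (lwhite j)) => ej.
  apply: conn_sym; apply: (@conn_trans _ (line j false, p + (0, 1))).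
    exact: conn_white.
  by apply: conn_black => //; rewrite -D ej -addrA subrK.
apply: (@conn_trans _ (line j false, p + hshift j)); first exact: conn_white.
apply: conn_black => //; rewrite -D (negPf ej).
by rewrite [p + (_ - _) + _]addrAC -[RHS]addrA subrK.
Qed.

Let conn_horiz j p : conn (base j p) (base (ordS j) (p + hshift j)).
Proof.
have eR k : lwhite k -> gdisp (line k true) = hshift k.
  by rewrite /gdisp /= => ->; rewrite subr0.
have eL k : ~~ lwhite k -> gdisp (line k true) = - hshift k.
  by rewrite /gdisp /= => /negPf ->; rewrite subr0.
rewrite /base; case: (boolP (hexagonal (ordS j))) => hv; last first.
  rewrite lwhiteS //; case: (boolP (lwhite j)) => ej /=.
    apply: conn_black; first by rewrite /gnode /= lwhiteS // ej.
    by rewrite eR // eL ?lwhiteS ?ej // addrK.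
  by apply: conn_white; rewrite /gnode /= lwhiteS // (negPf ej).
rewrite lwhiteSh //; case: (boolP (lwhite j)) => ej.
  apply: (@conn_trans _ (inr (exist _ (ordS j) hv), p + hshift j)).
    apply: conn_black; first by rewrite /gnode /= ej.
    by rewrite eR //= addr0.
  by apply: conn_white; rewrite /gnode /= lwhiteSh // ej.
apply: (@conn_trans _ (inr (exist _ (ordS j) hv), p + hshift j)).
  by apply: conn_white; rewrite /gnode /= (negPf ej).
apply: conn_black; first by rewrite /gnode /= lwhiteSh // (negPf ej).
by rewrite eL ?lwhiteSh // addrK /= addr0.
Qed.

Let conn_first (i0 j : 'I_n) p : val i0 = 0%N -> conn (base i0 p) (base j p).
Proof.
move=> e0; case: j => m; elim: m => [|m IH] hm.
  have -> : Ordinal hm = i0 by apply/val_inj.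
  exact: rst_refl.
apply: (conn_trans (IH (ltnW hm))).
have := conn_horiz (Ordinal (ltnW hm)) p.
have -> : hshift (Ordinal (ltnW hm)) = 0 by rewrite /hshift /= ltn_eqF.
have -> : ordS (Ordinal (ltnW hm)) = Ordinal hm.
  by apply/val_inj; rewrite /= modn_small.
by rewrite addr0.
Qed.

Let conn_translate (i0 : 'I_n) p q :
  val i0 = 0%N -> conn (base i0 p) (base i0 q).
Proof.
move=> e0; pose T r := forall p, conn (base i0 p) (base i0 (p + r)).
have TD r s : T r -> T s -> T (r + s).
  by move=> hr hs p'; rewrite addrA; apply: conn_trans (hr p') (hs _).
have TN r : T r -> T (- r).
  by move=> hr p'; apply: conn_sym; have := hr (p' - r); rewrite subrK.
have TM r (k : int) : T r -> T (r *~ k).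
  move=> hr; have Tn m : T (r *+ m).
    elim: m => [|m IH]; last by rewrite mulrS; exact: TD.
    by move=> p'; rewrite mulr0n addr0; exact: rst_refl.
  by case: k => m; [exact: Tn | rewrite NegzE mulrNz; apply/TN/Tn].
have T1 : T (1, - t).
  move=> p'; have hn : (n.-1 < n)%N by rewrite prednK //; case: (i0) => k /=; case: n.
  apply: (conn_trans (conn_first (Ordinal hn) p' e0)).
  have := conn_horiz (Ordinal hn) p'.
  have e : n.-1.+1 = n by case: (n) hn.
  have -> : ordS (Ordinal hn) = i0.
    by apply/val_inj; rewrite /= e modnn.
  by rewrite /hshift /= e eqxx.
have T2 : T (0, 1) by exact: conn_vert.
have pairMz (x : int * int) k : x *~ k = (x.1 *~ k, x.2 *~ k).
  have pairMn m : x *+ m = (x.1 *+ m, x.2 *+ m).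
    by elim: m => [|m IH]; rewrite ?mulr0n // !mulrS IH.
  by case: k => m; rewrite ?NegzE ?mulrNz -!pmulrn pairMn.
have -> : q = p + ((1, - t) *~ (q.1 - p.1)
                 + (0, 1) *~ (q.2 - p.2 + t * (q.1 - p.1))).
  rewrite !pairMz /=; case: p q => [p1 p2] [q1 q2]; apply/eqP.
  rewrite xpair_eqE /= !intz mul0rz addr0 subrKC eqxx /=.
  by rewrite -mulrzr intz mulNr [- _ + _]addrC addrK subrKC.
exact: TD (TM _ _ T1) (TM _ _ T2) p.
Qed.

Lemma gcover_connected u v : conn u v.
Proof.
have n0 (j : 'I_n) : (0 < n)%N by case: (n) j => [[]|].
have hub (w : gedge * (int * int)) (i0 : 'I_n) :
    val i0 = 0%N -> exists p, conn w (base i0 p).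
  move=> e0; case: w => x p.
  have [j ej] : exists j, gnode true x = gnode true (line j true).
    case: x => [[j s]|[v' hv]]; first by exists j.
    case: (boolP (lwhite v')) => ev; first by exists v'; rewrite /gnode /= ev.
    exists (ord_pred v'); have := hv; rewrite hexagonalE => /eqP e.
    by rewrite /gnode /= e (negPf ev) /= ord_predK.
  exists (if lwhite j then p else p - hshift j).
  apply: (conn_trans (conn_white p ej)); apply: conn_sym.
  have := conn_first j (if lwhite j then p else p - hshift j) e0.
  by rewrite {2}/base; case: (lwhite j) => //; rewrite subrK.
pose i0 := Ordinal (n0 (index_of u.1)).
have [p hp] := hub u i0 erefl; have [q hq] := hub v i0 erefl.
apply: (conn_trans hp); apply: conn_trans (conn_sym hq).
exact: conn_translate.
Qed.

End CoverConnected.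

Definition Gamma : dimer :=
  Dimer gwnext_inj gbnext_inj gwendP gbendP glfaceP gwend_surj gbend_surj
    glface_surj geuler gdispP gcover_connected.

Definition u (j : 'I_n) : {set edge Gamma} := [set line j true; line j false].

Lemma u_zigzag j : u j = zigzag (line j false : edge Gamma).
Proof.
have fix_zz y : fconnect (@zz Gamma) (line j false) y = (y == line j false).
  apply/idP/eqP => [/iter_findex <-|->]; last exact: connect0.
  by elim: (findex _ _ _) => //= m ->.
apply/setP => y; rewrite /u /zigzag !inE; apply/orP/existsP => [h|[z]].
  by exists (line j false); rewrite connect0 /= orbC; apply/orP.
by rewrite fix_zz => /andP[/eqP-> ]; rewrite orbC => /orP.
Qed.

Lemma face_adj_line (Z : {set edge Gamma}) j s : line j s \notin Z ->
  @face_adj Gamma Z j (ordS j) && @face_adj Gamma Z (ordS j) j.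
Proof.
move=> hZ; apply/andP; split; apply/existsP; exists (line j s); rewrite hZ;
  rewrite /tail /head -[lface _]/(glface (line j s));
  rewrite -[lface (wnext _)]/(glface (gwnext (line j s))) grface /=;
  by case: ifP => _; rewrite !eqxx ?orbT.
Qed.

Lemma face_adj_cases (Z : {set edge Gamma}) v w : @face_adj Gamma Z v w ->
  v = w \/ exists j s, line j s \notin Z /\
                       ((v = j /\ w = ordS j) \/ (v = ordS j /\ w = j)).
Proof.
case/existsP => -[[j s]|h] /andP[hZ]; rewrite /tail /head.
  rewrite -[lface _]/(glface (line j s)).
  rewrite -[lface (wnext _)]/(glface (gwnext (line j s))) grface /=.
  by case: ifP => _ /orP[] /andP[/eqP-> /eqP->]; right; exists j, s; auto.
rewrite -[lface _]/(glface (inr h)) -[lface (wnext _)]/(glface (gwnext (inr h))).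
by rewrite grfaceh /= => /orP[] /andP[/eqP-> /eqP->]; left.
Qed.

Lemma region_u i j :
  region (u i) (u j)
  = [set v : 'I_(nface Gamma) | (minn i j < v <= maxn i j)%N]%SET.
Proof.
set Z := u i :|: u j; pose e := @face_adj Gamma Z.
have outZ k s : (line k s \notin Z) = (k != i) && (k != j).
  rewrite /Z /u !inE -negb_or; congr (~~ _).
  have E l b : (line k s == line l b) = (k == l) && (s == b) by [].
  by rewrite !E; case: (s); rewrite ?andbT ?andbF ?orbF.
have conn1 k : k != i -> k != j -> connect e k (ordS k) && connect e (ordS k) k.
  move=> h1 h2; have := @face_adj_line Z k true; rewrite outZ h1 h2.
  by case/(_ isT)/andP => h3 h4; rewrite !connect1.
apply/setP => v; rewrite !inE; apply/forallP/idP => [h|hv v0]; last first.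
  apply/implyP => /eqP e0; apply/negP => /connectP[p hp ev].
  pose I := [pred w : 'I_n | (minn i j < w <= maxn i j)%N].
  have adjI x y : e x y -> I x = I y.
    case/face_adj_cases => [-> //|[k [s []]]]; rewrite outZ => /andP[h1 h2].
    have kk : I k = I (ordS k).
      rewrite /I /=; have := ltn_ord k; rewrite leq_eqVlt => /orP[/eqP ek|lk].
        rewrite ek modnn /=; apply/negbTE; rewrite negb_and -!ltnNge.
        have hi : (i < k)%N by rewrite ltn_neqAle eq_sym h1 -ltnS ek ltn_ord.
        have hj : (j < k)%N by rewrite ltn_neqAle eq_sym h2 -ltnS ek ltn_ord.
        by rewrite gtn_max hi hj orbT.
      have hmin : minn i j != k :> nat by rewrite /minn; case: ifP; rewrite eq_sym.
      have hmax : maxn i j != k :> nat by rewrite /maxn; case: ifP; rewrite eq_sym.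
      rewrite modn_small // ltnS [(minn i j < k)%N]ltn_neqAle hmin /=.
      by rewrite [(k < maxn i j)%N]ltn_neqAle eq_sym hmax.
    by case=> [] [-> ->].
  have last_I x q : path e x q -> I (last x q) = I x.
    by elim: q x => [//|y q IH] x /andP[/adjI -> /IH].
  have := last_I _ _ hp; rewrite -ev /I /= hv e0 ltn0; by [].
case hvI : (minn i j < v <= maxn i j)%N => //.
have i0P : (0 < n)%N by exact: leq_ltn_trans (leq0n v) (ltn_ord v).
pose i0 : 'I_n := Ordinal i0P.
have := h i0; rewrite eqxx /= => /negP[]; move: hvI => /negbT.
rewrite negb_and -leqNgt -ltnNge => /orP[hv|hv].
  case: v {h} hv => m; elim: m => [|m IH] hm /= hv.
    have -> : Ordinal hm = i0 by apply/val_inj.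
    exact: connect0.
  apply: (connect_trans (IH (ltnW hm) (ltnW hv))).
  have ne (l : 'I_n) : (minn i j <= l)%N -> Ordinal (ltnW hm) != l.
    move=> hl; rewrite -(inj_eq val_inj) /= ltn_eqF //; exact: leq_trans hv hl.
  have /andP[+ _] := conn1 _ (ne i (geq_minl _ _)) (ne j (geq_minr _ _)).
  have -> // : ordS (Ordinal (ltnW hm)) = Ordinal hm.
  by apply/val_inj; rewrite /= modn_small.
have [d] := ubnP (n - v); elim: d v {h} hv => // d IH v hv hd.
have ne (l : 'I_n) : (l <= maxn i j)%N -> v != l.
  by move=> hl; rewrite neq_ltn orbC (leq_ltn_trans hl hv).
have /andP[_ hc] := conn1 _ (ne i (leq_maxl _ _)) (ne j (leq_maxr _ _)).
apply: connect_trans hc; have := ltn_ord v; rewrite leq_eqVlt => /orP[/eqP ek|lk].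
  have -> : ordS v = i0 by apply/val_inj; rewrite /= [v.+1]ek modnn.
  exact: connect0.
apply: IH; rewrite /= modn_small //; first exact: ltnW.
by rewrite -ltnS (leq_trans _ hd) // ltnS ltn_sub2l // ltnW.
Qed.

End Gamma.

(* u_n < ... < u_1 *)
Definition u_lt n (i j : 'I_n) : bool := (j < i)%N.

Section Correspondence.
Variables (R : realType) (n a : nat) (pi : 'S_n) (c : bool) (t : int).
Local Notation Q := (Gamma a pi c t).

(* For consecutive entries k and l of w, the set R(u_w(k), u_w(l)) of faces and
   the hyperplane it defines. *)
Definition region_at (w : 'S_n) (k l : 'I_n) : {set 'I_(nface Q)} :=
  region (u a pi c t (w k)) (u a pi c t (w l)).

Definition hyp_at (w : 'S_n) (k l : 'I_n) : {vspace 'rV[R]_(nface Q)} :=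
  hyp R (region_at w k l).

Definition correspondence (Cw : 'S_n -> set 'rV[R]_(nface Q)) : Prop :=
  [/\ injective Cw,
      forall C, chamber C <-> exists w, Cw w = C
    & forall w (k l : 'I_n), val l = k.+1 ->
        is_wall (Cw w) (hyp_at w k l) /\
        forall theta, Cw w theta ->
          if u_lt (w k) (w l) then 0 < sum_on (region_at w k l) theta
          else sum_on (region_at w k l) theta < 0].

End Correspondence.

Section TypeA.
Variables (R : realType) (n : nat).
Local Notation V := 'rV[R]_n.

Definition sum_zero : {vspace V} :=
  lker (linfun (fun x : V => \sum_i x 0 i : R^o)).

Definition dot (x y : V) : R^o := \sum_i x 0 i * y 0 i.

Definition is_root (alpha : V) : Prop :=
  exists i j : 'I_n, i != j /\ alpha = delta_mx 0 i - delta_mx 0 j.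

Definition root_hyp (alpha : V) : {vspace V} :=
  (sum_zero :&: lker (linfun (dot alpha)))%VS.

Definition regular : set V :=
  [set x | x \in sum_zero /\
           forall alpha, is_root alpha -> x \notin root_hyp alpha].

Definition weyl_chamber (D : set V) : Prop :=
  exists2 x, regular x & D = connected_component regular x.

Definition fundamental_chamber : set V :=
  [set x | x \in sum_zero /\ forall i j : 'I_n, (i < j)%N -> x 0 j < x 0 i].

(* (weyl_act w x)_(w i) = x_i *)
Definition weyl_act (w : 'S_n) (x : V) : V := col_perm w^-1%g x.

End TypeA.

(* Main.v *)
Require Import Defs.
From HB Require Import structures.
From mathcomp Require Import all_boot all_order all_algebra fingroup perm.
From mathcomp Require Import complex.
From mathcomp Require Import boolp classical_sets reals topology num_topology.
From mathcomp Require Import normedtype zify ring lra.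

Set Implicit Arguments.
Unset Strict Implicit.
Unset Printing Implicit Defensive.

Import Order.TTheory GRing.Theory Num.Theory.
Import numFieldTopology.Exports numFieldNormedType.Exports.

Local Open Scope classical_set_scope.
Local Open Scope ring_scope.

(* Write x_j for a function on the lines whose jump across every face v is
   theta_v.  A subrepresentation is a set S of faces closed under the nonzero
   arrows, and going around the torus from left to right, theta(S) is the sum of
   x over the lines where one leaves S minus the sum over the lines where one
   enters S.  Hence M is theta-stable iff x_i < x_j whenever the leftward arrow
   across i and the rightward arrow across j both vanish on M, and theta is
   generic iff the x_j are distinct.  Conversely, the representations whose only
   nonzero arrows are the rightward ones across the lines with x_j < h and the
   leftward ones across those with x_j > h show that equivalent parameters order
   the lines in the same way.  So theta |-> x identifies the chambers with the
   Weyl chambers of type A. *)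

(** * Potentials on the lines *)

Lemma linfun_linear (K : fieldType) (U V : vectType K) (f : U -> V) :
  linear f -> linfun f =1 f.
Proof.
move=> fl u; pose F : {linear U -> V} :=
  HB.pack f (GRing.isLinear.Build _ _ _ _ f fl).
exact: (lfunE F).
Qed.

Lemma ordS_ind n (P : 'I_n -> Prop) i j :
  (forall k, P k -> P (ordS k)) -> P i -> P j.
Proof.
move=> PS Pi; have Pit m : P (iter m (@ordS n) i).
  by elim: m => //= m IH; exact: PS.
have vit m : iter m (@ordS n) i = ((i + m) %% n)%N :> nat.
  elim: m => [|m IH]; first by rewrite addn0 modn_small.
  by rewrite iterS /= IH -addn1 modnDml addn1 addnS.
(* The summand [n] avoids the truncated difference [j - i]: starting from [i], these steps lead to
   [n + j], that is, to [j] modulo [n]. *)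
suff -> : j = iter (n - i + j)%N (@ordS n) i by [].
by apply/val_inj; rewrite /= vit addnA subnKC ?(ltnW (ltn_ord i)) // modnDl modn_small.
Qed.

Lemma sum_ordS (V : nmodType) n (F : 'I_n -> V) :
  \sum_j F (ordS j) = \sum_j F j.
Proof.
by rewrite [RHS](reindex (@ordS n)) //; exists (@ord_pred n) => i _;
  rewrite ?ordSK ?ord_predK.
Qed.

Section Potential.
Variables (R : realType) (n : nat).
Implicit Types (p q y theta : 'rV[R]_n) (i j v : 'I_n).

(* The values of theta on the faces are the jumps, across the faces, of a
   function on the lines. *)
Definition jump y : 'rV[R]_n := \row_v (y 0 v - y 0 (ord_pred v)).

Definition mean y : R := n%:R^-1 * \sum_i y 0 i.

(** Partial sums give a function with jumps [theta], unique up to a constant; centring selects the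
    representative in [sum_zero], where [potential] and [jump] become mutually inverse. *)
Definition potential theta : 'rV[R]_n :=
  let y := \row_(j < n) (\sum_(v < n | (v <= j)%N) theta 0 v) in y - const_mx (mean y).

Lemma mem_sum_zero y : (y \in sum_zero R n) = (\sum_i y 0 i == 0).
Proof.
rewrite memv_ker linfun_linear // => c u v.
rewrite scaler_sumr -big_split; apply: eq_bigr => i _ /=.
by rewrite !mxE.
Qed.

Lemma sum_centred y : y - const_mx (mean y) \in sum_zero R n.
Proof.
have nE : n%:R * mean y = \sum_i y 0 i.
  rewrite mulrA; have [n0|n0] := posnP n; last by rewrite mulfV ?mul1r // pnatr_eq0 -lt0n.
  by rewrite big1 ?mulr0 // => -[m hm]; case/negP: (negbT (ltn0 m)); rewrite -n0.
rewrite mem_sum_zero (eq_bigr (fun i => y 0 i - mean y)) => [|i _]; last by rewrite !mxE.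
by rewrite sumrB sumr_const card_ord -[X in _ - X]mulr_natl nE subrr.
Qed.

Lemma potential_sum_zero theta : potential theta \in sum_zero R n.
Proof. exact: sum_centred. Qed.

Fact potential_is_linear : linear potential.
Proof.
move=> c u v; rewrite /potential.
have E : \row_(j < n) (\sum_(k < n | (k <= j)%N) (c *: u + v) 0 k)
    = c *: \row_(j < n) (\sum_(k < n | (k <= j)%N) u 0 k)
      + \row_(j < n) (\sum_(k < n | (k <= j)%N) v 0 k).
  apply/rowP => j; rewrite !mxE mulr_sumr -big_split.
  by apply: eq_bigr => k _; rewrite !mxE.
rewrite E; move: (\row_j _) (\row_j _) => {E v}v {}u.
have M : mean (c *: u + v) = c * mean u + mean v.
  rewrite /mean mulrCA -mulrDr; congr (_ * _).
  by rewrite mulr_sumr -big_split; apply: eq_bigr => k _; rewrite !mxE.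
by apply/rowP => j; rewrite M !mxE; ring.
Qed.

HB.instance Definition _ :=
  GRing.isLinear.Build R 'rV[R]_n 'rV[R]_n _ potential potential_is_linear.

Lemma potentialDZ p s q i :
  potential (p + s *: q) 0 i = potential p 0 i + s * potential q 0 i.
Proof.
by rewrite linearD linearZ /=; move: (potential p) (potential q) => x y; rewrite !mxE.
Qed.

(** Consecutive partial sums differ by one entry of [theta]. Across the face 0 the left neighbour is
    the last line, which carries the full sum, and this sum vanishes. *)
Lemma jump_potential theta :
  theta \in sum_zero R n -> jump (potential theta) = theta.
Proof.
rewrite mem_sum_zero => /eqP th0; apply/rowP => v.
rewrite !mxE opprD addrACA subrr addr0.
case: (posnP v) => [v0|v0].
  have n0 : (0 < n)%N by rewrite (leq_ltn_trans _ (ltn_ord v)).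
  rewrite (big_pred1 v) => [|k]; last by rewrite /= -val_eqE /= v0 leqn0.
  rewrite [X in _ - X](eq_bigl predT) ?th0 ?subr0 // => k.
  by rewrite /= v0 add0n modn_small ?ltn_predL // -ltnS prednK // ltn_ord.
rewrite (bigD1 v) //= -addrA -[RHS]addr0; congr (_ + _).
apply/eqP; rewrite subr_eq0; apply/eqP; apply: eq_bigl => k.
have -> : ((v + n).-1 %% n = v.-1)%N.
  rewrite -{1}(prednK v0) addSn /= modnDr modn_small //.
  by rewrite (leq_ltn_trans (leq_pred _)).
by rewrite -[RHS]ltnS prednK // ltn_neqAle andbC.
Qed.

Lemma jump_sum_zero y : jump y \in sum_zero R n.
Proof.
rewrite mem_sum_zero; apply/eqP.
rewrite (eq_bigr (fun i => y 0 i - y 0 (ord_pred i))) => [|i _]; last by rewrite mxE.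
rewrite sumrB -[X in _ - X]sum_ordS; apply/eqP; rewrite subr_eq0; apply/eqP.
by apply: eq_bigr => i _; rewrite ordSK.
Qed.

(** Two functions with the same jumps differ by a constant, as one sees by going around the cycle;
    summing over all lines identifies this constant. *)
Lemma potential_jump y : potential (jump y) = y - const_mx (mean y).
Proof.
set z := potential _; have zS : z \in sum_zero R n by exact: potential_sum_zero.
have jz : jump z = jump y by rewrite jump_potential // jump_sum_zero.
clearbody z.
have zy i j : z 0 j - y 0 j = z 0 i - y 0 i.
  apply: (@ordS_ind n (fun k => z 0 k - y 0 k = z 0 i - y 0 i) i) => // k <-.
  by move/rowP/(_ (ordS k)): jz; rewrite !mxE ordSK; lra.
apply/rowP => i; rewrite !mxE /mean.
have n0 : n%:R != 0 :> R by rewrite pnatr_eq0 -lt0n (leq_ltn_trans _ (ltn_ord i)).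
move: zS; rewrite mem_sum_zero => /eqP zS.
have : \sum_j (z 0 j - y 0 j) = \sum_(j < n) (z 0 i - y 0 i) by apply: eq_bigr.
rewrite sumrB zS sumr_const card_ord sub0r -[(_ - _) *+ n]mulr_natl => e.
by rewrite -mulrN e mulKf // subrKC.
Qed.

Lemma potential_jumpB y i j :
  potential (jump y) 0 i - potential (jump y) 0 j = y 0 i - y 0 j.
Proof. by rewrite potential_jump !mxE opprD addrACA subrr addr0. Qed.

Lemma potentialK y : y \in sum_zero R n -> potential (jump y) = y.
Proof.
rewrite mem_sum_zero potential_jump /mean => /eqP->; rewrite mulr0.
by apply/rowP => i; rewrite !mxE subr0.
Qed.

End Potential.

(** * Stability of representations *)

Section Closed.
Variables (R : realType) (D : dimer).
Local Notation Q0 := 'I_(nface D).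
Implicit Types (theta : 'rV[R]_(nface D)) (M : rep R D) (S : {set Q0}).

(** Each vertex carries a line, so a subrepresentation is determined by its support, and these are
    the possible supports. *)
Definition closed_under M S :=
  forall x, M x != 0 -> tail x \in S -> Defs.head x \in S.

Definition supp (N : Q0 -> {vspace R[i]^o}) : {set Q0} := [set v | N v != 0%VS]%SET.

(** A nonzero scalar carries a nonzero subspace of a line to a nonzero one. *)
Lemma subrep_closed M N : subrep M N -> closed_under M (supp N).
Proof.
move=> MN x Mx0; rewrite !inE => Nt.
have := MN x (vpick (N (tail x))) (memv_pick _).
apply: contraTneq => ->; rewrite memv0 mulf_eq0 negb_or Mx0.
by rewrite vpick0.
Qed.

Lemma dim_line (V : {vspace R[i]^o}) : \dim V = (V != 0%VS) :> nat.
Proof.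
rewrite -dimv_eq0.
have : (\dim V <= \dim {:R[i]^o})%N by rewrite dimvS ?subvf.
by rewrite dimvf /dim /=; case: (\dim V) => [|[]].
Qed.

Lemma theta_dim_supp theta N : theta_dim theta N = sum_on (supp N) theta.
Proof.
rewrite /sum_on big_mkcond; apply: eq_bigr => v _.
by rewrite inE dim_line; case: (N v == _).
Qed.

Definition span_on S v : {vspace R[i]^o} := if v \in S then fullv else 0%VS.

Lemma fullv_neq0 : fullv != 0%VS :> {vspace R[i]^o}.
Proof. by rewrite -dimv_eq0 dimvf. Qed.

Lemma supp_span_on S : supp (span_on S) = S.
Proof.
by apply/setP => v; rewrite inE /span_on; case: ifP; rewrite ?fullv_neq0 ?eqxx.
Qed.

Lemma subrep_span_on M S : closed_under M S -> subrep M (span_on S).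
Proof.
move=> cS x p; rewrite /span_on; case: ifP => [tS _|_].
  have [->|Mx] := eqVneq (M x) 0; first by rewrite mul0r mem0v.
  by rewrite cS // memvf.
by rewrite memv0 => /eqP->; rewrite mulr0 mem0v.
Qed.

Lemma semistable_closed theta M : semistable theta M <->
  forall S, closed_under M S -> 0 <= sum_on S theta.
Proof.
split=> [ss S cS|ss N MN]; last by rewrite theta_dim_supp ss //; exact: subrep_closed.
by rewrite -(supp_span_on S) -theta_dim_supp; exact/ss/subrep_span_on.
Qed.

Lemma stable_closed theta M : stable theta M <->
  forall S, closed_under M S -> S != finset.set0 -> S != [set: Q0]%SET -> 0 < sum_on S theta.
Proof.
split=> [st S cS S0 ST|st N MN [v Nv0] [w NwT]].
  rewrite -(supp_span_on S) -theta_dim_supp; apply: st.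
  - exact: subrep_span_on.
  - by case/set0Pn: S0 => v vS; exists v; rewrite /span_on vS fullv_neq0.
  - have [v vS] : exists v, v \notin S.
      by apply/existsP; rewrite -negb_forall; apply: contra ST => /forallP h;
        apply/eqP/setP => v; rewrite inE; have := h v.
    by exists v; rewrite /span_on (negPf vS) eq_sym fullv_neq0.
rewrite theta_dim_supp; apply: st; first exact: subrep_closed.
  by apply/set0Pn; exists v; rewrite inE.
(* A nonzero subspace of a line is the whole line, so a face with [N w] proper lies outside the
   support. *)
apply: contra_neq NwT => /setP/(_ w); rewrite !inE => Nw0.
by apply/eqP; rewrite eqEdim subvf dimvf dim_line Nw0.
Qed.

End Closed.

(** * Arcs of faces and summation by parts on the cycle *)

Lemma ltn_ordS n (i k : 'I_n) :
  (i < ordS k)%N = (i < k)%N (+) (k == i) (+) (k.+1 == n).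
Proof.
rewrite -[k == i]val_eqE /=; have := ltn_ord k; have := ltn_ord i.
case: (eqVneq k.+1 n) => [kn|kn] ltin ltkn; last by rewrite modn_small; lia.
by rewrite kn modnn; lia.
Qed.

(* The faces met on the way to the right from the line i to the line j. *)
Definition arc n (i j : 'I_n) : {set 'I_n} :=
  [set v : 'I_n | (i < v)%N (+) (j < v)%N (+) (j < i)%N]%SET.

(** Passing from [k] to [ordS k] flips [i < k] at [k = i], and once more when wrapping from [n - 1]
    to 0. The wraps for [i] and [j] cancel, so membership changes only at the two end lines. *)
Lemma in_arc_ordS n (i j k : 'I_n) :
  (ordS k \in arc i j) = (k \in arc i j) (+) (k == i) (+) (k == j).
Proof.
rewrite !inE !ltn_ordS; case: (i < k)%N; case: (j < k)%N; case: (j < i)%N;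
  by case: (k == i); case: (k == j); case: (_ == n).
Qed.

Lemma arc_left n (i j : 'I_n) : i \notin arc i j.
Proof. by rewrite inE ltnn addFb addbb. Qed.

Lemma arc_right n (i j : 'I_n) : i != j -> j \in arc i j.
Proof. by rewrite inE ltnn addbF -val_eqE /=; case: ltngtP. Qed.

Section SumByParts.
Variables (R : realType) (n : nat).
Implicit Types (theta : 'rV[R]_n) (S : {set 'I_n}).

(** Only the jumps of the potential matter, so the constant [m] is free; taking it to be the value
    at a given line kills the term of that line. *)
Lemma sum_by_parts theta S m : theta \in sum_zero R n ->
  \sum_(v in S) theta 0 v
  = \sum_j (potential theta 0 j - m) * ((j \in S)%:R - (ordS j \in S)%:R).
Proof.
move/jump_potential => {1}<-.
rewrite [LHS]big_mkcond (eq_bigr (fun v : 'I_n =>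
  (potential theta 0 v - m) * (v \in S)%:R
  - (potential theta 0 (ord_pred v) - m) * (v \in S)%:R)) => [|v _]; last first.
  by case: ifP => _; rewrite ?mulr1 ?mulr0 ?subrr // [LHS]mxE; lra.
rewrite sumrB -[X in _ - X]sum_ordS -sumrB.
by apply: eq_bigr => j _; rewrite ordSK mulrBr.
Qed.

Lemma sum_arc theta i j : theta \in sum_zero R n -> i != j ->
  \sum_(v in arc i j) theta 0 v = potential theta 0 j - potential theta 0 i.
Proof.
(* Relative to the value at [i], the line [j] is the only boundary line that contributes. *)
move=> th0 ij; rewrite (sum_by_parts _ (potential theta 0 i)) // (bigD1 j) //=.
rewrite in_arc_ordS arc_right // eqxx [j == i]eq_sym (negPf ij) subr0 mulr1.
rewrite big1 ?addr0 // => k kj; rewrite in_arc_ordS (negPf kj) addbF.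
have [->|_] := eqVneq k i; first by rewrite subrr mul0r.
by rewrite addbF subrr mulr0.
Qed.

End SumByParts.

(** * The arrows of the dual quiver *)

Section Arrows.
Variables (R : realType) (n a : nat) (pi : 'S_n) (c : bool) (t : int).
Local Notation Q := (Gamma a pi c t).
Implicit Types (M : rep R Q) (theta : 'rV[R]_n) (S : {set 'I_n}).

(** Two opposite arrows cross each line. Which of its two edges gives the arrow to the right depends
    on the colour of the leftmost nodes. *)
Definition fwd j : edge Q := line a pi j (lwhite a pi c j).
Definition bwd j : edge Q := line a pi j (~~ lwhite a pi c j).

Lemma tail_fwd j : tail (fwd j) = j.
Proof. by rewrite /tail /= eqxx. Qed.

Lemma head_fwd j : Defs.head (fwd j) = ordS j.
Proof. by rewrite /Defs.head [lface _]grface eqxx. Qed.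

Lemma tail_bwd j : tail (bwd j) = ordS j.
Proof. by rewrite /tail /=; case: (lwhite _ _ _). Qed.

Lemma head_bwd j : Defs.head (bwd j) = j.
Proof. by rewrite /Defs.head [lface _]grface; case: (lwhite _ _ _). Qed.

(** A horizontal edge has the same strip on both sides, hence gives a loop, which imposes nothing on
    closed sets of faces. *)
Variant edge_spec : edge Q -> Type :=
| EdgeFwd j : edge_spec (fwd j)
| EdgeBwd j : edge_spec (bwd j)
| EdgeLoop h : edge_spec (inr h).

Lemma edgeP x : edge_spec x.
Proof.
case: x => [[j s]|h]; last exact: EdgeLoop.
have [->|ne] := eqVneq s (lwhite a pi c j); first exact: (EdgeFwd j).
have -> : s = ~~ lwhite a pi c j by move: ne; case: s; case: (lwhite _ _ _ _).
exact: (EdgeBwd j).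
Qed.

Lemma closed_underP M S : @closed_under R Q M S <->
  (forall j, M (fwd j) != 0 -> j \in S -> ordS j \in S) /\
  (forall j, M (bwd j) != 0 -> ordS j \in S -> j \in S).
Proof.
split=> [cS|[cf cb] x].
  split=> j Mj; first by have := cS _ Mj; rewrite tail_fwd head_fwd.
  by have := cS _ Mj; rewrite tail_bwd head_bwd.
case: (edgeP x) => [j|j|h]; rewrite ?tail_fwd ?head_fwd ?tail_bwd ?head_bwd //.
- exact: cf.
- exact: cb.
- by rewrite /Defs.head [lface _]grfaceh.
Qed.

(** The only ways out of the arc are the rightward arrow across [j] and the leftward arrow across
    [i]. *)
Lemma closed_arc M i j : i != j -> M (fwd j) = 0 -> M (bwd i) = 0 ->
  @closed_under R Q M (arc i j).
Proof.
move=> ij fj bi; apply/closed_underP; split=> k; rewrite in_arc_ordS.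
  have [->|kj] := eqVneq k j; first by rewrite fj eqxx.
  have [->|ki] := eqVneq k i; first by rewrite (negPf (arc_left i j)).
  by rewrite !addbF.
have [->|ki] := eqVneq k i; first by rewrite bi eqxx.
have [->|kj] := eqVneq k j; first by rewrite arc_right.
by rewrite !addbF.
Qed.

End Arrows.

Section Boundary.
Variables (R : realType) (n : nat).
Implicit Types (theta : 'rV[R]_n) (S : {set 'I_n}).

Lemma ordS_closed S : S != finset.set0 -> (forall k, k \in S -> ordS k \in S) ->
  S = [set: 'I_n]%SET.
Proof.
case/set0Pn => i iS Sc; apply/setP => j; rewrite inE.
exact: (@ordS_ind n (fun k => k \in S) i).
Qed.

(* Take the highest entry i and the lowest exit j of S. *)
Lemma sum_boundary theta S : theta \in sum_zero R n ->
  S != finset.set0 -> S != [set: 'I_n]%SET ->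
  exists i j, [/\ i \notin S, ordS i \in S, j \in S, ordS j \notin S
    & potential theta 0 i <= potential theta 0 j ->
      potential theta 0 j - potential theta 0 i <= \sum_(v in S) theta 0 v].
Proof.
move=> th0 S0 ST; set x := potential theta 0.
pose entry k := (k \notin S) && (ordS k \in S).
pose exit k := (k \in S) && (ordS k \notin S).
have [i0 i0P] : exists k, entry k.
  apply/existsP; apply: contraNT S0 => /existsPn h.
  (* Without an entry, the complement of [S] is stable under steps to the right, hence contains all
     faces. *)
  have CT : ~: S = [set: 'I_n]%SET.
    apply: ordS_closed => [|k]; last first.
      by rewrite !inE => kS; have := h k; rewrite negb_and kS.
    by apply: contraNneq ST => /(congr1 (@finset.setC _)); rewrite finset.setCK finset.setC0 => ->.
  by rewrite -[S]finset.setCK CT finset.setCT.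
have [j0 j0P] : exists k, exit k.
  apply/existsP; apply: contraNT ST => /existsPn h; apply/eqP/ordS_closed => // k kS.
  by have := h k; rewrite negb_and kS negbK.
case: (@arg_maxP _ _ _ i0 entry x i0P) => i /andP[iS iSS] imax.
case: (@arg_minP _ _ _ j0 exit x j0P) => j /andP[jS jSS] jmin.
exists i, j; split=> // xij; rewrite (sum_by_parts S (x i)) //.
(* Relative to [x i], another exit contributes at least [x j - x i], which is nonnegative, and an
   entry contributes a nonnegative amount since [x i] is the highest entry value. *)
rewrite (bigD1 j) //= jS (negPf jSS) subr0 mulr1 lerDl sumr_ge0 // => k _.
case: (boolP (k \in S)) => kS; case: (boolP (ordS k \in S)) => kSS.
- by rewrite subrr mulr0.
- by rewrite subr0 mulr1 subr_ge0 (le_trans xij) // jmin // /exit kS kSS.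
- by rewrite sub0r mulrN1 opprB subr_ge0; apply: imax; rewrite /entry kS kSS.
- by rewrite subrr mulr0.
Qed.

End Boundary.

Section Stability.
Variables (R : realType) (n a : nat) (pi : 'S_n) (c : bool) (t : int).
Local Notation Q := (Gamma a pi c t).
Local Notation fwd := (@fwd n a pi c t).
Local Notation bwd := (@bwd n a pi c t).
Implicit Types (M : rep R Q) (theta : 'rV[R]_n) (S : {set 'I_n}).

(** Arcs give necessity. Conversely, closedness of a set forces the leftward arrow across each entry
    and the rightward arrow across each exit to vanish, so the condition applies to the pair given
    by [sum_boundary]. *)
Lemma semistableP theta M : theta \in sum_zero R n ->
  @semistable R Q theta M <-> forall i j, i != j -> M (fwd j) = 0 ->
    M (bwd i) = 0 -> potential theta 0 i <= potential theta 0 j.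
Proof.
move=> th0; rewrite semistable_closed; split=> [ss i j ij fj bi|h S].
  have := ss _ (closed_arc ij fj bi).
  by rewrite /sum_on sum_arc // subr_ge0.
case/closed_underP => Sf Sb; rewrite /sum_on.
have [->|S0] := eqVneq S finset.set0; first by rewrite big_set0.
have [->|ST] := eqVneq S [set: 'I_n]%SET.
  rewrite (eq_bigl predT) => [|v]; last by rewrite inE.
  by move: th0; rewrite mem_sum_zero => /eqP->.
have [i [j [iS iSS jS jSS le]]] := sum_boundary th0 S0 ST.
have xij : potential theta 0 i <= potential theta 0 j.
  apply: h; first by apply: contraNneq iS => ->.
    by apply/eqP; apply: contraNT jSS => /Sf; exact.
  by apply/eqP; apply: contraNT iS => /Sb; exact.
by apply: le_trans (le xij); rewrite subr_ge0.
Qed.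

Lemma stableP theta M : theta \in sum_zero R n ->
  @stable R Q theta M <-> forall i j, i != j -> M (fwd j) = 0 ->
    M (bwd i) = 0 -> potential theta 0 i < potential theta 0 j.
Proof.
move=> th0; rewrite stable_closed; split=> [ss i j ij fj bi|h S].
  have := ss _ (closed_arc ij fj bi).
  rewrite /sum_on sum_arc // subr_gt0; apply.
    by apply/set0Pn; exists j; exact: arc_right.
  by apply: contraNneq (arc_left i j) => ->; rewrite inE.
case/closed_underP => Sf Sb S0 ST; rewrite /sum_on.
have [i [j [iS iSS jS jSS le]]] := sum_boundary th0 S0 ST.
have xij : potential theta 0 i < potential theta 0 j.
  apply: h; first by apply: contraNneq iS => ->.
    by apply/eqP; apply: contraNT jSS => /Sf; exact.
  by apply/eqP; apply: contraNT iS => /Sb; exact.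
by apply: lt_le_trans (le (ltW xij)); rewrite subr_gt0.
Qed.

Lemma mem_behead_orbit ccw col x y :
  (y \in behead (fingraph.orbit (gnext (a := a) (pi := pi) c ccw col) x))
  = (y != x) && (gnode c col y == gnode c col x).
Proof.
set f := gnext c ccw col.
have E : fingraph.orbit f x = x :: behead (fingraph.orbit f x).
  by rewrite /fingraph.orbit -orderSpred.
have := fconnect_orbit f x y; rewrite gnodeP E inE /= [gnode c col y == _]eq_sym => ->.
have := orbit_uniq f x; rewrite E /= => /andP[+ _].
by case: (eqVneq y x) => //= ->; case: (x \in _).
Qed.

(* Around every end of an edge x there is, besides x, a loop or the two edges
   of some line. *)
Lemma satisfies_relations0 M : (forall h, M (inr h) = 0) ->
  (forall j, M (fwd j) * M (bwd j) = 0) -> @satisfies_relations R Q M.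
Proof.
move=> Mh Mj.
(* Both sides of every relation are zero, since each of the two paths contains a vanishing arrow. *)
suff K ccw col x :
    \prod_(y <- behead (fingraph.orbit (gnext (a := a) (pi := pi) c ccw col) x)) M y = 0.
  by move=> x; rewrite [LHS](K false true) [RHS](K true false).
have line0 j : line a pi j true != x -> line a pi j false != x ->
    gnode c col (line a pi j true) = gnode c col x ->
    exists y, [/\ y != x, gnode c col y = gnode c col x & M y = 0].
  move=> n1 n2 e; have := Mj j => /eqP; rewrite mulf_eq0 /fwd /bwd.
  by case: (lwhite _ _ _ _) => /= /orP[] /eqP My0;
    [exists (line a pi j true) | exists (line a pi j false)
    |exists (line a pi j false) | exists (line a pi j true)].
have [y [yx yn My0]] : exists y, [/\ y != x, gnode c col y = gnode c col x & M y = 0].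
  case: x line0 => [[j s]|[v hv]] line0.
    set v := gnode c col (inl (j, s)).
    have [hv|hv] := boolP (hexagonal a pi v).
      by exists (inr (exist _ v hv)).
    have [k kj kv] : exists2 k, k != j & gnode c col (line a pi k true) = v.
      move: hv; rewrite /v /gnode /=; case: ifP => r hv.
        exists (ordS j); last by rewrite /= lwhiteS // addbN r.
        (* The leftmost nodes have opposite colours on the two sides of a strip of rhombi, so its
           two boundary lines are distinct. *)
        by apply/eqP => e; have := lwhiteS c hv; rewrite e; case: (lwhite _ _ _ _).
      exists (ord_pred j); last by rewrite /= lwhiteP // addbN r /= ord_predK.
      by apply/eqP => e; have := lwhiteP c hv; rewrite e; case: (lwhite _ _ _ _).
    by apply: (line0 k) kv; apply: contra_neq kj => -[].
  have := hv; rewrite (hexagonalE _ _ c) => /eqP e.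
  case: (boolP (col (+) lwhite a pi c v)) => r.
    apply: (line0 (ord_pred v)) => //.
    by rewrite /gnode /= e r ord_predK.
  by apply: (line0 v) => //; rewrite /gnode /= (negPf r).
apply/eqP; rewrite prodf_seq_eq0; apply/hasP; exists y; last by rewrite My0 eqxx.
by rewrite mem_behead_orbit yx yn eqxx.
Qed.

End Stability.

(** * Chambers *)

Section Decreasing.
Variables (R : realType) (n : nat).
Implicit Types (w : 'S_n) (y : 'rV[R]_n) (i j k : 'I_n).

Definition decreasing_along w y :=
  forall i j, (i < j)%N -> y 0 (w j) < y 0 (w i).

Definition rank y k := #|[set m | y 0 k < y 0 m]%SET|.

Lemma decreasing_alongP w y i j : decreasing_along w y ->
  (y 0 (w j) < y 0 (w i)) = (i < j)%N.
Proof.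
move=> yw; case: (ltngtP i j) => [/yw //|/yw/ltW|/val_inj->]; last by rewrite ltxx.
by rewrite leNgt => /negPf.
Qed.

Lemma decreasing_along_inj w y : decreasing_along w y -> injective (y 0).
Proof.
move=> yw k l; rewrite -{1}(permKV w k) -{1}(permKV w l) => e.
have := decreasing_alongP (w^-1 k)%g (w^-1 l)%g yw.
have := decreasing_alongP (w^-1 l)%g (w^-1 k)%g yw.
rewrite e ltxx => h1 h2; apply: (@perm_inj _ w^-1%g); apply/val_inj/eqP.
by move: h1 h2; case: ltngtP.
Qed.

(** The entries larger than [y 0 (w i)] are those at [w j] with [j < i]; hence [y] determines
    [w]. *)
Lemma rank_decreasing w y i : decreasing_along w y -> rank y (w i) = i.
Proof.
move=> yw; have -> : rank y (w i) = #|w @: [set j : 'I_n | (j < i)%N]|%SET.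
  congr #|pred_of_set _|; apply/setP => m; rewrite -(permKV w m) inE decreasing_alongP //.
  by rewrite mem_imset ?inE //; exact: perm_inj.
rewrite card_imset; last exact: perm_inj.
rewrite -sum1_card (eq_bigl (fun j : 'I_n => (j < i)%N)) => [|j]; last by rewrite inE.
by rewrite (big_ord_narrow (ltnW (ltn_ord i))) sum1_card card_ord.
Qed.

Lemma decreasing_along_uniq w w' y :
  decreasing_along w y -> decreasing_along w' y -> w = w'.
Proof.
move=> yw yw'; apply/permP => i; have := rank_decreasing i yw.
by rewrite -{1}(permKV w' (w i)) rank_decreasing // => /val_inj {2}<-; rewrite permKV.
Qed.

Lemma ltn_rank y i j : (rank y i < rank y j)%N = (y 0 j < y 0 i).
Proof.
have [lt|le] := ltP (y 0 j) (y 0 i); last first.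
  apply/negbTE; rewrite -leqNgt; apply: subset_leq_card.
  by apply/fintype.subsetP => m; rewrite !inE; exact: le_lt_trans.
apply: proper_card; apply/properP; split; last by exists i; rewrite inE ?ltxx.
by apply/fintype.subsetP => m; rewrite !inE; exact: lt_trans.
Qed.

Lemma rank_ltn y k : (rank y k < n)%N.
Proof.
rewrite -[X in (_ < X)%N](card_ord n) -cardsT; apply: proper_card.
by apply/properP; split; [exact: finset.subsetT | exists k; rewrite !inE ?ltxx].
Qed.

(** When the values are distinct, the ranks form a permutation, whose inverse lists the indices from
    the highest value to the lowest. *)
Lemma decreasing_along_ex y : injective (y 0) -> exists w, decreasing_along w y.
Proof.
move=> yi; have ri : injective (fun k => Ordinal (rank_ltn y k)).
  move=> i j /(congr1 val) /= e; apply: yi; apply/eqP; rewrite eq_le !leNgt.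
  by rewrite -!ltn_rank e ltnn.
exists (perm ri)^-1%g => i j ij.
have rk k : rank y ((perm ri)^-1%g k) = k.
  by rewrite -[in RHS](permKV (perm ri) k) permE.
by rewrite -ltn_rank !rk.
Qed.

End Decreasing.

Section Chambers.
Variables (R : realType) (n a : nat) (pi : 'S_n) (c : bool) (t : int).
Local Notation Q := (Gamma a pi c t).
Local Notation fwd := (@fwd n a pi c t).
Local Notation bwd := (@bwd n a pi c t).
Implicit Types (M : rep R Q) (theta : 'rV[R]_n) (C : set 'rV[R]_n) (w : 'S_n).

Lemma mem_Theta theta : (theta \in Theta R Q) = (theta \in sum_zero R n).
Proof.
rewrite mem_sum_zero memv_ker linfun_linear => [|k u v].
  by rewrite /sum_on; congr (_ == _); apply: eq_bigl => v; rewrite inE.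
rewrite /sum_on scaler_sumr -big_split; apply: eq_bigr => i _ /=.
by rewrite !mxE.
Qed.

(* With h = x_i, it is semistable; it is not stable if x_i = x_j for some
   j != i, and stable if x is injective. *)
Definition level_rep theta (h : R) : rep R Q := fun x =>
  if x is inl (j, s) then
    if (if s == lwhite a pi c j then potential theta 0 j < h
        else h < potential theta 0 j) then 1 else 0
  else 0.

Lemma level_rep_fwd theta h j :
  level_rep theta h (fwd j) = 0 <-> h <= potential theta 0 j.
Proof.
rewrite /level_rep /= eqxx leNgt; case: ifP => _ //; split=> // /eqP.
by rewrite oner_eq0.
Qed.

Lemma level_rep_bwd theta h j :
  level_rep theta h (bwd j) = 0 <-> potential theta 0 j <= h.
Proof.
rewrite /level_rep /= leNgt.
have -> : (~~ lwhite a pi c j == lwhite a pi c j) = false by case: (lwhite _ _ _ _).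
by case: ifP => _ //; split=> // /eqP; rewrite oner_eq0.
Qed.

Lemma level_rep_relations theta h : satisfies_relations (level_rep theta h).
Proof.
apply: satisfies_relations0 => // j.
have [le|lt] := leP h (potential theta 0 j).
  by have /level_rep_fwd -> := le; rewrite mul0r.
by have /level_rep_bwd -> := ltW lt; rewrite mulr0.
Qed.

(** Semistability and stability differ only by weak against strict comparisons, which agree for
    distinct values. A coincidence of two values is detected by [level_rep] at the common height. *)
Lemma genericP theta : @generic R Q theta <->
  theta \in sum_zero R n /\ injective (potential theta 0).
Proof.
rewrite /generic mem_Theta; split=> [[th0 gen]|[th0 xi]]; split=> //; last first.
  move=> M _ /semistableP ss; apply/stableP => // i j ij fj bi.
  by rewrite lt_neqAle ss // andbT; apply: contra_neq ij => /xi.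
move=> i j xij; apply/eqP; apply: contraT => ij.
have ss : @semistable R Q theta (level_rep theta (potential theta 0 i)).
  apply/semistableP => // k l _ /level_rep_fwd ll /level_rep_bwd lk.
  exact: le_trans ll.
have /stableP := gen _ (level_rep_relations _ _) ss.
move/(_ th0 i j ij); rewrite xij ltxx; apply; first exact/level_rep_fwd.
by apply/level_rep_bwd; rewrite xij.
Qed.

(** If [i] lies below [j], the stable representation at the height of [i] has no leftward arrow
    across [i] and no rightward arrow across [j], so its stability for [theta'] gives the
    comparison. One implication suffices because both orders on the lines are total. *)
Lemma equivalentP theta theta' : @generic R Q theta -> @generic R Q theta' ->
  @equivalent R Q theta theta' <-> forall i j,
    potential theta 0 i < potential theta 0 j ->
    potential theta' 0 i < potential theta' 0 j.
Proof.
move=> /genericP[th0 xi] /genericP[th0' xi']; split=> [eqv i j xij|h M _].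
  have : @stable R Q theta (level_rep theta (potential theta 0 i)).
    apply/stableP => // k l kl /level_rep_fwd ll /level_rep_bwd lk.
    by rewrite lt_neqAle (le_trans lk ll) andbT; apply: contra_neq kl => /xi.
  move/(eqv _ (level_rep_relations _ _)).1/stableP => /(_ th0' i j) -> //.
  - by apply: contraTneq xij => ->; rewrite ltxx.
  - exact/level_rep_fwd/ltW.
  - exact/level_rep_bwd.
split=> /stableP => [/(_ th0)|/(_ th0')] st; apply/stableP => // i j ij fj bi.
  exact/h/st.
have := st i j ij fj bi.
case: (ltgtP (potential theta 0 i) (potential theta 0 j)) => // [/h/lt_trans h'|/xi e _].
  by move/h'; rewrite ltxx.
by rewrite e eqxx in ij.
Qed.

(** The candidate for the chamber attached to [w]. *)
Definition cone w : set 'rV[R]_n :=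
  [set theta | theta \in sum_zero R n /\ decreasing_along w (potential theta)].

Lemma cone_neq0 w : cone w !=set0.
Proof.
(* Up to a constant, its potential takes the value [- i] on the line [w i]. *)
exists (jump (\row_k - ((w^-1)%g k)%:R)); split; first exact: jump_sum_zero.
move=> i j ij; rewrite -subr_gt0 potential_jumpB !mxE !permK opprK addrC.
by rewrite subr_gt0 ltr_nat.
Qed.

Lemma cone_generic w theta : cone w theta -> @generic R Q theta.
Proof. by case=> th0 /decreasing_along_inj xi; apply/genericP. Qed.

Lemma cone_uniq w w' theta : cone w theta -> cone w' theta -> w = w'.
Proof. by move=> [_ h] [_ h']; exact: decreasing_along_uniq h h'. Qed.

Lemma cone_inj : injective cone.
Proof.
move=> w w' e; have [theta wth] := cone_neq0 w.
by apply: (cone_uniq wth); rewrite -e.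
Qed.

Lemma cone_class w theta : cone w theta ->
  cone w = [set theta' | @generic R Q theta' /\ @equivalent R Q theta theta'].
Proof.
move=> wth; have gth := cone_generic wth; have [th0 xw] := wth.
apply/seteqP; split=> theta'.
  move=> wth'; have gth' := cone_generic wth'; split=> //.
  apply/equivalentP => // k l; rewrite -(permKV w k) -(permKV w l).
  by rewrite (decreasing_alongP _ _ xw) => /(wth'.2).
case=> gth' /(equivalentP gth gth') h; split; first by have /genericP[] := gth'.
by move=> i j /xw/h.
Qed.

Lemma chamberP C : @chamber R Q C <-> exists w, cone w = C.
Proof.
split=> [[theta gth ->]|[w <-]].
  have /genericP[th0 /decreasing_along_ex[w xw]] := gth.
  by exists w; exact: cone_class.
by have [theta wth] := cone_neq0 w; exists theta;
  [exact: cone_generic wth | exact: cone_class].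
Qed.

End Chambers.

(** * Continuity, closures and connectedness *)

Section Topology.
Variables (R : realType) (n : nat).
Implicit Types (p q : 'rV[R]_n) (A : set 'rV[R]_n).

Lemma segment_continuous p q : continuous (fun s : R => p + s *: q).
Proof. by move=> s; apply: cvgD; [exact: cvg_cst | exact: scalel_continuous]. Qed.

Lemma rV_functional_continuous (f : 'rV[R]_n -> R^o) :
  linear f -> continuous (f : 'rV[R]_n -> R).
Proof.
move=> fl; pose F : {linear 'rV[R]_n -> R^o} :=
  HB.pack f (GRing.isLinear.Build _ _ _ _ f fl).
have -> : f = fun x => \sum_i (x 0 i * f (delta_mx 0 i) : R).
  apply/funext => x; rewrite -[f]/(F : _ -> _) {1}(row_sum_delta x) linear_sum.
  by apply: eq_bigr => i _; rewrite linearZ.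
apply: continuous_big; first exact: add_continuous.
move=> i _ x; exact: cvgM (@coord_continuous _ _ _ 0 i x) (cvg_cst _).
Qed.

Lemma closure_segment A p q :
  (forall s, 0 < s -> A (p + s *: q)) -> closure A p.
Proof.
move=> Apq B pB.
have : nbhs (0 : R) [set s | B (p + s *: q)].
  by apply: segment_continuous; rewrite scale0r addr0.
case/nbhs_ballP => e /= e0 eB; exists (p + (e / 2) *: q); split.
  by apply: Apq; rewrite divr_gt0.
apply: eB; rewrite /ball /= sub0r normrN ger0_norm; last by rewrite divr_ge0 ?ltW.
by rewrite ltr_pdivrMr // ltr_pMr // ltr1n.
Qed.

(** A nonempty convex set is the union of the segments from one of its points. *)
Lemma convex_connected A :
  (forall p q s, A p -> A q -> 0 <= s -> s <= 1 -> A (p + s *: (q - p))) ->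
  connected A.
Proof.
move=> Acvx; have [->|/set0P[p Ap]] := eqVneq A set0; first exact: connected0.
have -> : A = \bigcup_(q in A) ((fun s => p + s *: (q - p)) @` `[0, 1]).
  apply/seteqP; split=> q.
    by exists q => //; exists 1; rewrite ?scale1r ?subrKC //= in_itv /= ler01 lexx.
  by case=> q' Aq' [s] /=; rewrite in_itv /= => /andP[s0 s1] <-; exact: Acvx.
apply: bigcup_connected.
  by exists p => q Aq; exists 0; rewrite ?scale0r ?addr0 //= in_itv /= ler01 lexx.
move=> q Aq; apply: connected_continuous_connected; first exact: segment_connected.
apply: continuous_subspaceT; exact: segment_continuous.
Qed.

End Topology.

Lemma perturb (R : realFieldType) (I : finType) (f g : I -> R) :
  (forall i, 0 < f i) -> exists2 e, 0 < e & forall i, 0 < f i + e * g i.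
Proof.
move=> f0; have d0 i : 0 < 1 + `|g i| by rewrite ltr_pwDl.
(* The added 1 in the denominator leaves a margin: [f i + e * g i] is at least [e]. *)
pose e := \big[Num.min/1]_i (f i / (1 + `|g i|)).
have e0 : 0 < e.
  by apply: lt_bigmin => [|i _]; [exact: ltr01 | rewrite divr_gt0].
exists e => // i.
have : e * (1 + `|g i|) <= f i by rewrite -ler_pdivlMr // bigmin_le.
have : - `|g i| <= g i by rewrite lerNl ler_normr lexx orbT.
move=> h1 h2; have := ler_wpM2l (ltW e0) h1.
by move: h2; rewrite mulrN mulrDr mulr1; lra.
Qed.

(** By rank-nullity, as the image of [U] is a nonzero subspace of a line. *)
Lemma dim_cap_lker (K : fieldType) (V : vectType K) (U : {vspace V})
    (f : 'Hom(V, K^o)) u : u \in U -> f u != 0 ->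
  (\dim (U :&: lker f)).+1 = \dim U.
Proof.
move=> uU fu0; rewrite -(limg_ker_dim f U) -addn1; congr (_ + _)%N.
apply/eqP; rewrite eqn_leq; apply/andP; split; last first.
  by rewrite (leq_trans (dimvS (subvf _))) // dimvf.
rewrite lt0n dimv_eq0; apply: contraNneq fu0 => e.
by rewrite -memv0 -e memv_img.
Qed.

(** * Walls *)

Section ClosedCones.
Variables (R : realType) (n : nat).
Implicit Types (theta q : 'rV[R]_n) (w : 'S_n) (i j k l : 'I_n).

Lemma closure_ge0 (f : 'Hom('rV[R]_n, R^o)) (A : set 'rV[R]_n) :
  (forall theta, A theta -> 0 <= f theta) ->
  forall theta, closure A theta -> 0 <= f theta.
Proof.
move=> fA; have fl : linear (f : _ -> _) by move=> s u v; rewrite linearP.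
have cf := rV_functional_continuous fl.
have cl : closed ((f : 'rV[R]_n -> R) @^-1` [set x | 0 <= x]).
  by apply: preimage_closed => [x _|]; [exact: cf | exact: closed_ge].
move=> theta /(closureS (B := (f : 'rV[R]_n -> R) @^-1` [set x | 0 <= x])).
by rewrite -((closure_id _).1 cl); apply => ? /fA.
Qed.

Definition height k l : 'Hom('rV[R]_n, R^o) :=
  linfun (fun theta => potential theta 0 k - potential theta 0 l : R^o).

Lemma heightE k l theta :
  height k l theta = potential theta 0 k - potential theta 0 l.
Proof.
by rewrite linfun_linear // => s u v; rewrite linearP !mxE /= /GRing.scale /=; ring.
Qed.

Definition total : 'Hom('rV[R]_n, R^o) :=
  linfun (fun theta => \sum_i theta 0 i : R^o).

Lemma totalE theta : total theta = \sum_i theta 0 i.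
Proof.
rewrite linfun_linear // => s u v.
rewrite scaler_sumr -big_split; apply: eq_bigr => i _ /=.
by rewrite !mxE.
Qed.

Definition weakly_decreasing_along w (y : 'rV[R]_n) :=
  forall i j, (i < j)%N -> y 0 (w j) <= y 0 (w i).

(** Weak inequalities pass to the closure. Conversely, adding a positive multiple of a point of the
    cone makes all of them strict. *)
Lemma closure_cone w : closure (@cone R n w) =
  [set theta | theta \in sum_zero R n
               /\ weakly_decreasing_along w (potential theta)].
Proof.
apply/seteqP; split=> theta.
  move=> clt; split=> [|i j ij].
    (* The equation is passed to the closure as two opposite inequalities. *)
    rewrite mem_sum_zero eq_le -oppr_ge0 -totalE -[- total _]opp_lfunE.
    apply/andP; split; apply: closure_ge0 clt => theta' [+ _];
      by rewrite mem_sum_zero ?opp_lfunE totalE => /eqP->; rewrite ?oppr0.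
  rewrite -subr_ge0 -heightE; apply: closure_ge0 clt => theta' [_ xw].
  by rewrite heightE subr_ge0 ltW // xw.
case=> th0 xw; have [q [q0 qw]] := cone_neq0 R w.
apply: (@closure_segment _ _ _ _ q) => s s0; split=> [|i j ij].
  by rewrite memvD // memvZ.
by rewrite !potentialDZ ler_ltD ?xw // ltr_pM2l // qw.
Qed.

Lemma perturb_potential (p q : 'rV[R]_n) : exists2 e, 0 < e &
  forall i j, potential p 0 i < potential p 0 j ->
    potential (p + e *: q) 0 i < potential (p + e *: q) 0 j.
Proof.
pose f (m : 'I_n * 'I_n) := potential p 0 m.2 - potential p 0 m.1.
(* Pairs without a strict inequality at [p] receive the dummy margin 1. *)
have f0 m : 0 < (if 0 < f m then f m else 1) by case: ifP.
have [e e0 h] := perturb (fun m => potential q 0 m.2 - potential q 0 m.1) f0.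
exists e => // i j; rewrite -subr_gt0 => pij; have := h (i, j).
by rewrite /f /= pij !potentialDZ; lra.
Qed.

(* A point of the facet x_(w k) = x_(w l) which lies on no other hyperplane. *)
Definition facet_point w k l : 'rV[R]_n :=
  jump (\row_m - (if m == w l then k : nat else (w^-1)%g m)%:R).

Lemma facet_pointB w k l i j :
  potential (facet_point w k l) 0 (w i) - potential (facet_point w k l) 0 (w j)
  = (if j == l then k else j)%:R - (if i == l then k else i)%:R.
Proof.
by rewrite potential_jumpB !mxE !(inj_eq perm_inj) !permK opprK addrC; do 2 case: ifP.
Qed.

Lemma facet_point_lt w k l i j : val l = k.+1 -> (i < j)%N ->
  (i, j) != (k, l) ->
  potential (facet_point w k l) 0 (w j) < potential (facet_point w k l) 0 (w i).
Proof.
move=> kl ij ijkl; rewrite -subr_gt0 facet_pointB subr_gt0 ltr_nat.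
move: ijkl; rewrite xpair_eqE -!val_eqE /= kl.
by case: ifP; case: ifP; lia.
Qed.

Lemma facet_point_weak w k l : val l = k.+1 ->
  weakly_decreasing_along w (potential (facet_point w k l)).
Proof.
move=> kl i j ij; have [[-> ->]|ne] := eqVneq (i, j) (k, l).
  rewrite -subr_ge0 facet_pointB eqxx -val_eqE /= kl.
  by case: ifP => [|_]; [lia | rewrite subrr].
exact/ltW/facet_point_lt.
Qed.

(** An adjacent transposition inverts no pair except the one it swaps, and permutes the other
    increasing pairs among themselves. *)
Lemma ltn_tperm k l i j : val l = k.+1 -> (i < j)%N -> (i, j) != (k, l) ->
  (tperm k l i < tperm k l j)%N && ((tperm k l i, tperm k l j) != (k, l)).
Proof.
move=> kl ij; rewrite !xpair_eqE -!val_eqE /=.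
have E m : val (tperm k l m) =
    if m == k :> nat then k.+1 else if m == k.+1 :> nat then k : nat else m.
  rewrite -kl; case: tpermP => [->|->|/eqP mk /eqP ml]; rewrite ?eqxx //.
    by case: eqP => //; rewrite kl; lia.
  by rewrite !val_eqE (negPf mk) (negPf ml).
by rewrite [nat_of_ord (tperm _ _ i)]E [nat_of_ord (tperm _ _ j)]E kl;
  (repeat case: ifP); lia.
Qed.

End ClosedCones.

Section Walls.
Variables (R : realType) (n a : nat) (pi : 'S_n) (c : bool) (t : int).
Local Notation Q := (Gamma a pi c t).
Local Notation cone := (@cone R n).
Local Notation hyp_at := (hyp_at R a pi c t).
Implicit Types (theta : 'rV[R]_n) (w : 'S_n) (i j k l : 'I_n).
Implicit Types (F : set 'rV[R]_n) (W : {vspace 'rV[R]_n}).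

(** The region avoids the face 0, so it is the arc from the smaller to the larger index, which does
    not wrap around. *)
Lemma sum_region theta i j : theta \in sum_zero R n -> i != j ->
  sum_on (region (u a pi c t i) (u a pi c t j)) theta
  = if (i < j)%N then height R j i theta else height R i j theta.
Proof.
move=> th0 ij; rewrite region_u !heightE /sum_on.
have [lt|le] := ltnP i j.
  rewrite -sum_arc //; apply: eq_bigl => v; rewrite !inE.
  by move: (nat_of_ord v) => m; lia.
have lt : (j < i)%N by rewrite ltn_neqAle le andbT eq_sym.
rewrite -sum_arc 1?eq_sym //; apply: eq_bigl => v; rewrite !inE.
by move: (nat_of_ord v) => m; lia.
Qed.

Lemma mem_Theta_cap (f : 'Hom('rV[R]_n, R^o)) theta :
  (theta \in (Theta R Q :&: lker f)%VS) = (theta \in sum_zero R n) && (f theta == 0).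
Proof. by rewrite memv_cap mem_Theta memv_ker. Qed.

Lemma mem_hyp_at w k l theta : k != l -> (theta \in hyp_at w k l) =
  (theta \in sum_zero R n) && (potential theta 0 (w k) == potential theta 0 (w l)).
Proof.
move=> kl; rewrite memv_cap mem_Theta; case: (boolP (theta \in sum_zero R n)) => //= th0.
have wkl : w k != w l by rewrite (inj_eq perm_inj).
have lin : linear (@sum_on R Q (region_at a pi c t w k l)).
  move=> s p q; rewrite /sum_on scaler_sumr -big_split.
  by apply: eq_bigr => v _; rewrite !mxE.
rewrite memv_ker linfun_linear // sum_region //.
by case: ifP => _; rewrite heightE subr_eq0 // eq_sym.
Qed.

Lemma hyp_atE w k l : k != l ->
  hyp_at w k l = (Theta R Q :&: lker (height R (w k) (w l)))%VS.
Proof.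
move=> kl; apply/vspaceP => theta.
by rewrite mem_hyp_at // mem_Theta_cap heightE subr_eq0.
Qed.

Lemma neq_succ k l : val l = k.+1 -> k != l.
Proof. by move=> kl; rewrite -val_eqE kl /= neq_ltn ltnSn. Qed.

Lemma dim_hyp_at w k l : k != l -> (\dim (hyp_at w k l)).+1 = \dim (Theta R Q).
Proof.
move=> kl; rewrite hyp_atE //.
(* A parameter whose potentials at [w k] and [w l] differ by 1. *)
apply: (@dim_cap_lker _ _ _ _ (jump (delta_mx 0 (w k)))).
  by rewrite mem_Theta jump_sum_zero.
rewrite heightE potential_jumpB !mxE !eqxx (inj_eq perm_inj) [l == k]eq_sym (negPf kl).
by rewrite subr0 oner_neq0.
Qed.

Definition facet w k l : set 'rV[R]_n :=
  [set theta | closure (cone w) theta /\ height R (w k) (w l) theta = 0].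

(** The point [p] is interior to the facet relative to the hyperplane: for [q] in the hyperplane,
    [p + e *: q] stays in the facet when [e] is small, so [q] is a combination of two points of the
    facet. *)
Lemma facet_spanningP w k l : val l = k.+1 ->
  @facet_spanning R Q (hyp_at w k l) (cone w) (facet w k l).
Proof.
move=> kl; have nkl := neq_succ kl.
have ltkl : (k < l)%N by rewrite kl.
split; last exact: dim_hyp_at.
  exists (height R (w k) (w l)); split=> // theta; rewrite closure_cone.
  by case=> _ xw; rewrite heightE subr_ge0 xw.
split=> [theta [+ h]|U FU].
  rewrite closure_cone mem_hyp_at // => -[-> _] /=.
  by rewrite -subr_eq0 -heightE h.
have FE theta : theta \in sum_zero R n ->
    weakly_decreasing_along w (potential theta) ->
    potential theta 0 (w k) = potential theta 0 (w l) -> theta \in U.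
  move=> th0 xw e; apply: FU; rewrite /facet closure_cone; split=> //=.
  by rewrite heightE e subrr.
pose p := facet_point R w k l.
have p0 : p \in sum_zero R n by exact: jump_sum_zero.
have pkl : potential p 0 (w k) = potential p 0 (w l).
  apply/eqP; rewrite -subr_eq0 facet_pointB eqxx.
  by rewrite (negPf nkl) subrr.
apply/subvP => q; rewrite mem_hyp_at // => /andP[q0 /eqP qkl].
have [e e0 h] := perturb_potential p q.
have pqU : p + e *: q \in U.
  apply: FE; first by rewrite memvD // memvZ.
    move=> i j ij; have [[-> ->]|ne] := eqVneq (i, j) (k, l).
      by rewrite !potentialDZ pkl qkl.
    exact/ltW/h/facet_point_lt.
  by rewrite !potentialDZ pkl qkl.
have pU : p \in U by apply: FE => //; exact: facet_point_weak.
have -> : q = e^-1 *: (p + e *: q - p).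
  by rewrite [p + _]addrC addrK scalerA mulVf ?scale1r // gt_eqF.
by rewrite memvZ // memvB.
Qed.

(** Products of permutations apply the left factor first, so [tperm k l * w] is [w] with its entries
    at [k] and [l] swapped. Swapping two lines of equal potential does not affect a weakly
    decreasing order. *)
Lemma facet_tperm w k l : val l = k.+1 ->
  facet (tperm k l * w)%g k l = facet w k l.
Proof.
(* The transposition is an involution, so one inclusion for all permutations is enough. *)
move=> kl; suff sub w' : facet w' k l `<=` facet (tperm k l * w')%g k l.
  apply/seteqP; split; last exact: sub.
  by move/sub: (tperm k l * w)%g; rewrite mulgA tperm2 mul1g.
move=> theta; rewrite /facet !closure_cone /= => -[[th0 xw]].
rewrite !heightE !permM tpermL tpermR => /eqP; rewrite subr_eq0 => /eqP e.
split; last by rewrite e subrr.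
split=> // i j ij; rewrite !permM.
have [[-> ->]|ne] := eqVneq (i, j) (k, l); first by rewrite tpermL tpermR e.
by have /andP[lt _] := ltn_tperm kl ij ne; exact: xw.
Qed.

Lemma hyp_at_tperm w k l : k != l -> hyp_at (tperm k l * w)%g k l = hyp_at w k l.
Proof.
move=> kl; apply/vspaceP => theta.
by rewrite [LHS]mem_hyp_at // [RHS]mem_hyp_at // !permM tpermL tpermR [X in _ && X]eq_sym.
Qed.

Lemma cone_tperm w k l theta : val l = k.+1 -> cone (tperm k l * w)%g theta ->
  potential theta 0 (w k) < potential theta 0 (w l).
Proof.
move=> kl [_ xw]; have := xw k l; rewrite kl !permM tpermL tpermR.
exact.
Qed.

Lemma adjacent_tperm w k l : val l = k.+1 ->
  @adjacent_across R Q (hyp_at w k l) (cone w) (cone (tperm k l * w)%g).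
Proof.
move=> kl; split.
  exists (facet w k l); split; first exact: facet_spanningP.
  by rewrite -facet_tperm // -hyp_at_tperm ?neq_succ //; exact: facet_spanningP.
exists (height R (w k) (w l)); split; first by rewrite hyp_atE ?neq_succ.
  by move=> theta [_ xw]; rewrite heightE subr_gt0 xw // kl.
by move=> theta /cone_tperm xw; rewrite heightE subr_lt0 xw.
Qed.

(* A common facet of the cones of w and w' is not contained in any other
   hyperplane, so that w and w' order all the other pairs of lines in the same
   way. *)
Lemma adjacent_unique w w' k l : val l = k.+1 ->
  @adjacent_across R Q (hyp_at w k l) (cone w) (cone w') ->
  w' = (tperm k l * w)%g.
Proof.
move=> kl [[F [[[f [_ FE]] [_ Fspan] _] [[f' [_ FE']] _ _]]] [g [_ g1 g2]]].
have nkl := neq_succ kl.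
have [q [q0 qw']] := cone_neq0 R w'.
have other i j : (i < j)%N -> (i, j) != (k, l) ->
    potential q 0 (w j) < potential q 0 (w i).
  move=> ij ne.
  (* Otherwise the span of [F], which is the whole wall, would lie in the hyperplane of the pair
     [(i, j)], although [facet_point] does not. *)
  have [theta Fth] : exists2 theta, F theta & height R (w i) (w j) theta != 0.
    apply: contrapT => nF.
    have : facet_point R w k l \in (Theta R Q :&: lker (height R (w i) (w j)))%VS.
      have /subvP : (hyp_at w k l <= Theta R Q :&: lker (height R (w i) (w j)))%VS.
        apply: Fspan => theta Fth; rewrite mem_Theta_cap.
        apply/andP; split; last first.
          by apply: contrapT => /negP h0; apply: nF; exists theta.
        by move: Fth; rewrite FE closure_cone => -[[]].
      apply; rewrite mem_hyp_at // jump_sum_zero -subr_eq0 facet_pointB eqxx.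
      by rewrite (negPf nkl) subrr eqxx.
    rewrite mem_Theta_cap heightE => /andP[_].
    by rewrite subr_eq0 gt_eqF // facet_point_lt.
  rewrite heightE subr_eq0 => ne0; move: (Fth); rewrite FE closure_cone => -[[_ xw] _].
  have {xw} := xw i j ij; rewrite le_eqVlt eq_sym (negPf ne0) /= => lt.
  (* The same point is in the closure of the cone of [w'], which therefore cannot order this pair
     the other way. *)
  move: Fth; rewrite FE' closure_cone => -[[_ xw'] _].
  have E m : w m = w' ((w'^-1)%g (w m)) by rewrite permKV.
  rewrite E [w i]E decreasing_alongP // ltnNge.
  apply: contraTN lt; rewrite -leNgt leq_eqVlt => /orP[/eqP/val_inj/perm_inj ->//|].
  by move=> /xw'; rewrite -!E.
apply: (@cone_uniq R _ _ _ q) => //; split=> // i j ij; rewrite !permM.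
have [[-> ->]|ne] := eqVneq (i, j) (k, l); last first.
  by have /andP[lt ne'] := ltn_tperm kl ij ne; exact: other.
rewrite tpermL tpermR lt_neqAle (inj_eq (decreasing_along_inj qw')) (inj_eq perm_inj).
rewrite nkl /= leNgt; apply/negP => lt.
(* Otherwise [q] would lie in the cones of both [w] and [w'], which [g] strictly separates. *)
have qw : cone w q.
  split=> // i' j' ij'; have [[-> ->]//|ne] := eqVneq (i', j') (k, l).
  exact: other.
by have := lt_trans (g1 _ qw) (g2 q (conj q0 qw')); rewrite ltxx.
Qed.

(* Otherwise the face would contain a point of the open cone, where a functional
   cannot vanish without vanishing on Theta. *)
Lemma wall_hyp_at w W : @is_wall R Q (cone w) W ->
  exists k l, val l = k.+1 /\ W = hyp_at w k l.
Proof.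
case=> F [[f [f0 FE]] [FW Fspan] dimW].
have F0 : F 0.
  rewrite FE; split; last exact: linear0.
  rewrite closure_cone; split=> [|i j _]; first exact: mem0v.
  by rewrite linear0 !mxE.
(* Either an equality between consecutive lines holds on all of [F], and a dimension count gives the
   wall, or every consecutive inequality is strict at some point of [F]. *)
have [[k [l [kl h]]]|none] :=
    pselect (exists k l : 'I_n, val l = k.+1 /\
      forall theta : 'rV[R]_n, F theta -> height R (w k) (w l) theta = 0).
  exists k, l; split=> //; apply/eqP; rewrite eqEdim; apply/andP; split.
    apply: Fspan => theta Fth; rewrite mem_hyp_at ?neq_succ //.
    rewrite -subr_eq0 -heightE h // eqxx andbT.
    by move: Fth; rewrite FE closure_cone => -[[]].
  by rewrite -ltnS dim_hyp_at ?neq_succ // dimW.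
have /choice[T hT] : forall k, exists theta, F theta /\ forall l, val l = k.+1 ->
    potential theta 0 (w l) < potential theta 0 (w k).
  move=> k; have [kn|kn] := ltnP k.+1 n; last first.
    (* The last position has no successor, so any point of [F] will do. *)
    by exists 0; split=> // l lk; have := ltn_ord l; rewrite [X in (X < _)%N]lk ltnNge kn.
  pose l := Ordinal kn.
  have [theta Fth h] : exists2 theta, F theta & height R (w k) (w l) theta != 0.
    apply: contrapT => nF; apply: none; exists k, l; split=> // theta Fth.
    by apply: contrapT => /eqP h; apply: nF; exists theta.
  exists theta; split=> // l' kl'; have -> : l' = l by exact/val_inj.
  move: Fth; rewrite FE closure_cone => -[[_ /(_ k l (ltnSn _))] + _].
  rewrite le_eqVlt => /orP[/eqP e|//].
  by rewrite heightE e subrr eqxx in h.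
(* All summands are weakly decreasing along [w] and [T k] is strict after position [k], so the sum
   lies in the open cone. *)
pose p := \sum_k T k.
have FT k : F (T k) by case: (hT k).
have Tw k : weakly_decreasing_along w (potential (T k)).
  by have := FT k; rewrite FE closure_cone => -[[]].
have potE i : potential p 0 i = \sum_k potential (T k) 0 i.
  by rewrite /p linear_sum summxE.
have pw : cone w p.
  split=> [|i j ij].
    rewrite memv_suml // => k _.
    by have := FT k; rewrite FE closure_cone => -[[]].
  rewrite !potE -subr_gt0 -sumrB (bigD1 i) //= ltr_pwDl //; last first.
    by apply: sumr_ge0 => k _; rewrite subr_ge0 Tw.
  have iSn : (i.+1 < n)%N by apply: leq_ltn_trans ij (ltn_ord j).
  rewrite subr_gt0; apply: le_lt_trans ((hT i).2 (Ordinal iSn) erefl).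
  move: ij; rewrite leq_eqVlt => /orP[/eqP e|lt]; last exact: Tw.
  by have -> : j = Ordinal iSn by exact/val_inj.
have fp : f p = 0.
  by rewrite /p linear_sum big1 // => k _; have := FT k; rewrite FE => -[].
have near_p theta : theta \in Theta R Q ->
    exists2 e, 0 < e & cone w (p + e *: theta).
  rewrite mem_Theta => th0; have [e e0 h] := perturb_potential p theta.
  exists e => //; split=> [|i j ij]; last exact/h/pw.2.
  by rewrite memvD ?memvZ // pw.1.
have fge theta : theta \in Theta R Q -> 0 <= f theta.
  move=> /near_p[e e0 /subset_closure/f0].
  by rewrite linearD linearZ /= fp add0r -[_ *: _]/(e * f theta) pmulr_rge0.
have fTheta theta : theta \in Theta R Q -> f theta = 0.
  move=> th; apply/eqP; rewrite eq_le fge // andbT -oppr_ge0 -linearN fge //.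
  by rewrite memvN.
(* As [f] vanishes on [Theta], the face [F] contains the whole open cone, which spans [Theta]; this
   contradicts the dimension of [W]. *)
have : (Theta R Q <= W)%VS.
  apply/subvP => theta th; have [e e0 pe] := near_p _ th.
  have FA q : cone w q -> F q.
    by move=> qw; rewrite FE; split; [exact: subset_closure | rewrite fTheta // mem_Theta qw.1].
  have -> : theta = e^-1 *: (p + e *: theta - p).
    by rewrite [p + _]addrC addrK scalerA mulVf ?scale1r // gt_eqF.
  by rewrite memvZ // memvB // FW //; exact: FA.
by move/dimvS; rewrite -dimW ltnn.
Qed.

Lemma is_wall_hyp_at w k l : val l = k.+1 -> @is_wall R Q (cone w) (hyp_at w k l).
Proof. by move=> kl; exists (facet w k l); exact: facet_spanningP. Qed.

(** Both the sign convention and the orientation of the region depend on which index is larger, and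
    the two dependences cancel. *)
Lemma sign_regionP w k l theta : val l = k.+1 -> theta \in sum_zero R n ->
  (if u_lt (w k) (w l) then 0 < sum_on (region_at a pi c t w k l) theta
   else sum_on (region_at a pi c t w k l) theta < 0)
  <-> potential theta 0 (w l) < potential theta 0 (w k).
Proof.
move=> kl th0; have wkl : w k != w l by rewrite (inj_eq perm_inj) neq_succ.
rewrite /u_lt sum_region // !heightE; move: wkl; rewrite -val_eqE.
by case: ltngtP => // _ _; rewrite ?subr_gt0 ?subr_lt0.
Qed.

Lemma cone_correspondence : @correspondence R n a pi c t cone.
Proof.
split; [exact: cone_inj | by move=> C; exact: chamberP | move=> w k l kl].
split; first exact: is_wall_hyp_at.
by move=> theta [th0 xw]; apply/sign_regionP => //; apply: xw; rewrite kl.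
Qed.

(** The set [Cw w] is the cone of some [w']. The sign conditions at consecutive positions chain
    together, so a point of it is also in the cone of [w], which forces [w' = w]. *)
Lemma correspondence_unique (Cw : 'S_n -> set 'rV[R]_n) :
  @correspondence R n a pi c t Cw -> cone = Cw.
Proof.
case=> _ Cch sgn; apply/funext => w.
have [w' e] : exists w', cone w' = Cw w.
  by apply/(@chamberP R n a pi c t)/Cch; exists w.
rewrite -e; congr cone.
have [theta th] := cone_neq0 R w'; have [th0 _] := th.
have step k l : val l = k.+1 -> potential theta 0 (w l) < potential theta 0 (w k).
  by move=> kl; apply/sign_regionP => //; apply: (sgn w k l kl).2; rewrite -e.
apply: (@cone_uniq R _ _ _ theta) => //; split=> // i [m]; elim: m => // m IH hm.
rewrite ltnS leq_eqVlt => /orP[/eqP e'|lt].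
  by apply: step; rewrite /= e'.
apply: lt_trans (IH (ltnW hm) lt); exact: step.
Qed.

End Walls.

(** * Weyl chambers *)

Section WeylChambers.
Variables (R : realType) (n : nat).
Implicit Types (x y theta : 'rV[R]_n) (w : 'S_n) (i j k l : 'I_n).

Definition weyl_cone w : set 'rV[R]_n :=
  [set y | y \in sum_zero R n /\ decreasing_along w y].

Lemma dot_linear x : linear (dot x).
Proof.
move=> s u v; rewrite /dot scaler_sumr -big_split; apply: eq_bigr => i _ /=.
by rewrite !mxE /GRing.scale /=; ring.
Qed.

Lemma mem_root_hyp i j y : (y \in root_hyp (delta_mx 0 i - delta_mx 0 j)) =
  (y \in sum_zero R n) && (y 0 i == y 0 j).
Proof.
rewrite memv_cap memv_ker linfun_linear; last exact: dot_linear.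
rewrite /dot (eq_bigr (fun k => (k == i)%:R * y 0 k - (k == j)%:R * y 0 k)).
  have D l : \sum_k (k == l)%:R * y 0 k = y 0 l.
    rewrite (bigD1 l) //= eqxx mul1r big1 ?addr0 // => k /negPf->.
    by rewrite mul0r.
  by rewrite sumrB !D subr_eq0.
by move=> k _; rewrite !mxE /= mulrBl.
Qed.

Lemma regularP y : @regular R n y <-> y \in sum_zero R n /\ injective (y 0).
Proof.
split=> [[y0 h]|[y0 yi]]; split=> //.
  move=> i j e; apply: contrapT => /eqP ij; have := h (delta_mx 0 i - delta_mx 0 j).
  by rewrite mem_root_hyp y0 e eqxx => /(_ _)/negP; apply; [exists i, j|].
move=> _ [i [j [ij ->]]].
by rewrite mem_root_hyp y0 /=; apply: contraNN ij => /eqP/yi->.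
Qed.

Lemma regular_cone y : @regular R n y <-> exists w, weyl_cone w y.
Proof.
rewrite regularP; split=> [[y0 /decreasing_along_ex[w yw]]|[w [y0 yw]]].
  by exists w.
by split=> //; exact: decreasing_along_inj yw.
Qed.

Lemma weyl_cone_connected w : connected (weyl_cone w).
Proof.
apply: convex_connected => p q s [p0 pw] [q0 qw] s0 s1; split=> [|i j ij].
  by rewrite memvD // memvZ // memvB.
have := pw i j ij; have := qw i j ij; rewrite !mxE -subr_gt0 => hq; rewrite -subr_gt0 => hp.
(* At the endpoint [s = 1] strictness comes from [q], elsewhere from [p]. *)
have [e|ne] := eqVneq s 1; first by rewrite e; lra.
have h1 : 0 < (1 - s) * (p 0 (w i) - p 0 (w j)).
  by rewrite mulr_gt0 // subr_gt0 lt_neqAle ne.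
by have h2 := mulr_ge0 s0 (ltW hq); lra.
Qed.

(** Regular points have distinct coordinates, so each inequality defining the cone cuts out a subset
    of the component that is both open and closed, hence all of it. *)
Lemma component_weyl_cone w y : weyl_cone w y ->
  connected_component (@regular R n) y = weyl_cone w.
Proof.
move=> yw; have ry : @regular R n y by apply/regular_cone; exists w.
set A := connected_component _ _.
have Areg : A `<=` @regular R n by exact: connected_component_sub.
have Ay : A y by exact: connected_component_refl.
apply/seteqP; split; last first.
  apply: connected_component_max => //; last exact: weyl_cone_connected.
  by move=> z zw; apply/regular_cone; exists w.
suff sub i j : (i < j)%N -> A `<=` [set z : 'rV[R]_n | z 0 (w j) < z 0 (w i)].
  move=> z Az; split; first by have /regularP[] := Areg z Az.
  by move=> i j ij; exact: sub ij z Az.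
move=> ij; have fl : linear (fun z : 'rV[R]_n => z 0 (w i) - z 0 (w j) : R^o).
  by move=> s u v; rewrite !mxE /GRing.scale /=; ring.
have cf := rV_functional_continuous fl.
have cA : connected A by exact: component_connected.
have AE := cA (A `&` [set z : 'rV[R]_n | z 0 (w j) < z 0 (w i)]).
rewrite -[A in A `<=` _]AE; first by move=> z [].
- by exists y; split=> //; exact: yw.2.
- exists [set z : 'rV[R]_n | z 0 (w j) < z 0 (w i)] => //.
  have : open ((fun z : 'rV[R]_n => z 0 (w i) - z 0 (w j)) @^-1` [set r | r > 0]).
    by apply: open_comp => [z _|]; [exact: cf | exact: open_gt].
  by congr open; apply/seteqP; split=> z; rewrite /= subr_gt0.
- exists [set z : 'rV[R]_n | z 0 (w j) <= z 0 (w i)].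
    have := @preimage_closed _ _ _ [set r : R | r >= 0] (fun z _ => cf z) (@closed_ge _ _).
    by congr closed; apply/seteqP; split=> z; rewrite /= subr_ge0.
  apply/seteqP; split=> z /= [Az]; first by move=> /ltW.
  rewrite le_eqVlt => /orP[/eqP e|//]; have /regularP[_ zi] := Areg z Az.
  by move/zi/perm_inj: e ij => ->; rewrite ltnn.
Qed.

Lemma weyl_cone_neq0 w : weyl_cone w !=set0.
Proof.
have [theta [_ xw]] := cone_neq0 R w.
by exists (potential theta); split=> //; exact: potential_sum_zero.
Qed.

Lemma weyl_chamberP (D : set 'rV[R]_n) :
  @weyl_chamber R n D <-> exists w, weyl_cone w = D.
Proof.
split=> [[y /regular_cone[w yw] ->]|[w <-]].
  by exists w; rewrite (component_weyl_cone yw).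
have [y yw] := weyl_cone_neq0 w; exists y; first by apply/regular_cone; exists w.
by rewrite (component_weyl_cone yw).
Qed.

Lemma weyl_act_fundamental w :
  weyl_act w @` @fundamental_chamber R n = weyl_cone w.
Proof.
have sumE s y : \sum_i (col_perm s y) 0 i = \sum_i y 0 i.
  rewrite [RHS](reindex_inj (@perm_inj _ s)) /=.
  by apply: eq_bigr => i _; rewrite mxE.
apply/seteqP; split=> y.
  case=> z [z0 zlt] <-; split; first by move: z0; rewrite !mem_sum_zero sumE.
  by move=> i j ij; rewrite !mxE !permK zlt.
case=> y0 yw; exists (col_perm w y).
  split; first by move: y0; rewrite !mem_sum_zero sumE.
  by move=> i j ij; rewrite !mxE yw.
by apply/rowP => i; rewrite !mxE permKV.
Qed.

(** The linear identification of the parameter space with the standard space of type A, once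
    restricted to [Theta]. *)
Definition pot : 'Hom('rV[R]_n, 'rV[R]_n) := linfun (@potential R n).

Lemma potE theta : pot theta = potential theta.
Proof. exact: lfunE. Qed.

Lemma pot_inj theta theta' : theta \in sum_zero R n -> theta' \in sum_zero R n ->
  pot theta = pot theta' -> theta = theta'.
Proof.
move=> th0 th0'; rewrite !potE => e.
by rewrite -(jump_potential th0) e jump_potential.
Qed.

Lemma pot_cone w : pot @` (cone w) = weyl_cone w.
Proof.
apply/seteqP; split=> y.
  by case=> theta [th0 xw] <-; rewrite potE; split=> //; exact: potential_sum_zero.
case=> y0 yw; exists (jump y); last by rewrite potE potentialK.
by split; [exact: jump_sum_zero | rewrite potentialK].
Qed.

End WeylChambers.

(** * Chambers and walls under the identification with type A *)

Section TypeAWalls.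
Variables (R : realType) (n a : nat) (pi : 'S_n) (c : bool) (t : int).
Local Notation Q := (Gamma a pi c t).
Local Notation hyp_at := (hyp_at R a pi c t).
Implicit Types (w : 'S_n) (i j k l : 'I_n).

Lemma Theta_cap_ker_pot : (Theta R Q :&: lker (pot R n))%VS = 0%VS.
Proof.
apply/eqP; rewrite -subv0; apply/subvP => theta /memv_capP[].
rewrite mem_Theta => th0; rewrite memv_ker => /eqP e; rewrite memv0; apply/eqP.
by apply: (pot_inj th0); rewrite ?mem0v // e linear0.
Qed.

Lemma pot_Theta : (pot R n @: Theta R Q)%VS = sum_zero R n.
Proof.
apply/vspaceP => y; apply/memv_imgP/idP => [[theta _ ->]|y0].
  by rewrite potE potential_sum_zero.
by exists (jump y); [rewrite mem_Theta jump_sum_zero | rewrite potE potentialK].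
Qed.

Lemma pot_hyp_at w k l : k != l -> (pot R n @: hyp_at w k l)%VS
  = root_hyp (delta_mx 0 (w k) - delta_mx 0 (w l)).
Proof.
move=> kl; apply/vspaceP => y; rewrite mem_root_hyp; apply/memv_imgP/andP.
  case=> theta; rewrite mem_hyp_at // => /andP[_ e] ->; rewrite potE.
  by split=> //; exact: potential_sum_zero.
case=> y0 e; exists (jump y); last by rewrite potE potentialK.
by rewrite mem_hyp_at // jump_sum_zero potentialK.
Qed.

Lemma perm_two k l i j : k != l -> i != j -> exists w : 'S_n, w k = i /\ w l = j.
Proof.
(* The first transposition sends [k] to [i]; the second brings the image of [l] to [j] without
   moving [i]. *)
move=> kl ij; exists (tperm k i * tperm (tperm k i l) j)%g.
rewrite !permM tpermL; split; last by rewrite tpermL.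
have ne : tperm k i l != i by rewrite -{2}(tpermL k i) (inj_eq perm_inj) eq_sym.
by rewrite (tpermD ne) // eq_sym.
Qed.

Lemma pot_img_inj (W W' : {vspace 'rV[R]_n}) : (W <= Theta R Q)%VS ->
  (W' <= Theta R Q)%VS -> (pot R n @: W <= pot R n @: W')%VS -> (W <= W')%VS.
Proof.
move=> /subvP WT /subvP WT' /subvP WW'; apply/subvP => theta thW.
have /memv_imgP[theta' thW' e] := WW' _ (memv_img _ thW).
have := WT _ thW; rewrite mem_Theta => h.
have := WT' _ thW'; rewrite mem_Theta => h'.
by rewrite (pot_inj h h' e).
Qed.

Lemma hyp_at_sub w k l : (hyp_at w k l <= Theta R Q)%VS.
Proof. exact: capvSl. Qed.

(** Every root hyperplane bounds some chamber: place the two lines of the root at the first two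
    positions of [w]. Subspaces of [Theta] are determined by their images under [pot]. *)
Lemma wall_root (W : {vspace 'rV[R]_n}) : (W <= Theta R Q)%VS ->
  (exists C, @chamber R Q C /\ @is_wall R Q C W)
  <-> exists alpha, is_root alpha /\ (pot R n @: W)%VS = root_hyp alpha.
Proof.
move=> WT; split=> [[C [/chamberP[w <-] /wall_hyp_at[k [l [kl ->]]]]]|].
  exists (delta_mx 0 (w k) - delta_mx 0 (w l)); split; last by rewrite pot_hyp_at ?neq_succ.
  by exists (w k), (w l); rewrite (inj_eq perm_inj) neq_succ.
case=> _ [[i [j [ij ->]]] WE].
have n1 : (1 < n)%N.
  by have := ltn_ord i; have := ltn_ord j; move: ij; rewrite -val_eqE /=; lia.
pose k := Ordinal (ltnW n1); pose l := Ordinal n1.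
have kl : val l = k.+1 by [].
have [w [wk wl]] := perm_two (neq_succ kl) ij.
have imgE : (pot R n @: W)%VS = (pot R n @: hyp_at w k l)%VS.
  by rewrite pot_hyp_at ?neq_succ // wk wl.
have -> : W = hyp_at w k l.
  apply/eqP; rewrite eqEsubv; apply/andP.
  by split; apply: pot_img_inj; rewrite ?imgE ?hyp_at_sub ?subvv.
exists (cone w); split; last exact: is_wall_hyp_at.
by apply/chamberP; exists w.
Qed.

(** As [pot] is injective on [Theta], a subset of [Theta] is recovered from its image. *)
Lemma chamber_weyl (C : set 'rV[R]_n) :
  C `<=` [set theta | theta \in Theta R Q] ->
  @chamber R Q C <-> weyl_chamber (pot R n @` C).
Proof.
move=> CT; rewrite chamberP weyl_chamberP; split=> -[w e]; exists w.
  by rewrite -e pot_cone.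
move: e; rewrite -pot_cone => e.
have CT' theta : C theta -> theta \in sum_zero R n by move=> /CT; rewrite /= mem_Theta.
apply/seteqP; split=> theta.
  move=> wth; have : (pot R n @` C) (pot R n theta) by rewrite -e; exists theta.
  by case=> theta' Cth' /pot_inj <- //; [exact: CT' | exact: wth.1].
move=> Cth; have : (pot R n @` cone w) (pot R n theta) by rewrite e; exists theta.
by case=> theta' wth' /pot_inj <- //; [exact: wth'.1 | exact: CT'].
Qed.

End TypeAWalls.

Theorem theorem1p2 (R : realType) (a b : nat) (ha : (1 <= a)%N)
    (hab : (b <= a)%N) (pi : 'S_(a + b)) (c : bool) (t : int)
    (hslopes : perm_eq (slopes (Gamma a pi c t))
       (nseq a (0, -1) ++ nseq b (0, 1)
          ++ [:: (1, a%:Z - b%:Z); (-1, 0)])) :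
  exists Cw : 'S_(a + b) -> set 'rV[R]_(nface (Gamma a pi c t)),
    [/\ unique (@correspondence R (a + b) a pi c t) Cw,
        (forall (w : 'S_(a + b)) (k l : 'I_(a + b)), val l = k.+1 ->
           forall C, chamber C ->
             (adjacent_across (hyp_at R a pi c t w k l) (Cw w) C
                <-> C = Cw (tperm k l * w)%g))
      & exists phi : 'Hom('rV[R]_(nface (Gamma a pi c t)), 'rV[R]_(a + b)),
          [/\ (Theta R (Gamma a pi c t) :&: lker phi)%VS = 0%VS
                /\ (phi @: Theta R (Gamma a pi c t))%VS = sum_zero R (a + b),
              (forall C, C `<=` [set theta | theta \in Theta R (Gamma a pi c t)] ->
                 (chamber C <-> weyl_chamber (phi @` C))),
              (forall W : {vspace 'rV[R]_(nface (Gamma a pi c t))},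
                 (W <= Theta R (Gamma a pi c t))%VS ->
                 ((exists C, chamber C /\ is_wall C W)
                    <-> exists alpha, is_root alpha
                                   /\ (phi @: W)%VS = root_hyp alpha))
            & forall w : 'S_(a + b),
                phi @` Cw w = weyl_act w @` @fundamental_chamber R (a + b)]].
Proof.
exists (@cone R (a + b)); split.
- by split; [exact: cone_correspondence | exact: correspondence_unique].
- move=> w k l kl C /chamberP[w' <-]; split=> [adj|->]; last exact: adjacent_tperm.
  by congr cone; exact: adjacent_unique adj.
exists (pot R (a + b)); split.
- by split; [exact: Theta_cap_ker_pot | exact: pot_Theta].
- by move=> C; exact: chamber_weyl.
- by move=> W; exact: wall_root.
- by move=> w; rewrite weyl_act_fundamental; exact: pot_cone.
Qed.
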